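(* Let $\lambda(N)$ be a sequence of signatures, $\lambda(N)$ of size $N$, and let $f:[0,1]\to\mathbb R$ be a weakly decreasing function. Suppose that $f$ is piecewise-differentiable, $R_\infty(\lambda(N),f)=O(1)$ (i.e., it is bounded) and $R_1(\lambda(N),f)/\sqrt N$ goes to $0$ as $N\to\infty$. Then for any fixed $h\in\mathbb C$, $$S_{\lambda(N)}\bigl(e^{h/\sqrt N};N,1\bigr)=\exp\left(\sqrt N\,E(f)\,h+\frac12S(f)\,h^2+o(1)\right)\qquad(N\to\infty),$$ where $$E(f)=\int_0^1f(t)\,dt,\qquad S(f)=\int_0^1f(t)^2\,dt-E(f)^2+\int_0^1f(t)(1-2t)\,dt.$$ Moreover, the remainder $o(1)$ is uniform over $h$ belonging to compact subsets of $\mathbb C\setminus\{0\}$.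
   Context: A signature of size $N$ is an $N$-tuple of integers $\lambda_1\ge\cdots\ge\lambda_N$. The Schur function is the symmetric Laurent polynomial $s_\lambda(u_1,\dots,u_N)=\det[u_i^{\lambda_j+N-j}]_{i,j=1}^N/\prod_{i<j}(u_i-u_j)$ and $S_\lambda(x;N,1)=s_\lambda(x,1^{N-1})/s_\lambda(1^N)$, where $1^m$ stands for $m$ arguments equal to $1$. Notation: $$R_1(\lambda(N),f)=\sum_{j=1}^N\left|\frac{\lambda_j(N)}N-f(j/N)\right|,\qquad R_\infty(\lambda(N),f)=\sup_{j=1,\dots,N}\left|\frac{\lambda_j(N)}N-f(j/N)\right|.$$ *)

(* Defs.v *)
From HB Require Import structures.
From mathcomp Require Import all_boot all_order all_algebra.
From mathcomp Require Import all_classical all_reals all_analysis.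
From mathcomp Require Import fraction complex.
(* The notations of mpoly clash with those of mathcomp-analysis. *)
From mathcomp Require Import -(notations) mpoly.

Set Implicit Arguments.
Unset Strict Implicit.
Unset Printing Implicit Defensive.

Import Order.TTheory GRing.Theory Num.Theory numFieldNormedType.Exports.

Local Open Scope classical_set_scope.
Local Open Scope ring_scope.
Local Open Scope complex_scope.

(* Ordinals count from 0: [lam i] is lambda_(i+1). *)
Definition signature (N : nat) (lam : 'I_N -> int) : Prop :=
  forall i j : 'I_N, (i <= j)%N -> lam j <= lam i.

Section Schur.
Variables (F : fieldType) (N : nat).

Definition ratfun : fieldType := {fraction (mpoly.mpoly N F)}.

Definition ratX (i : 'I_N) : ratfun := tofrac (mpolyX F (mnm1 i)).

(* The exponent lambda_j + N - j of the 1-based convention is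
   [lam j + (N - j.+1)] for the 0-based index [j]; it may be negative. *)
Definition alternant (K : fieldType) (lam : 'I_N -> int) (u : 'I_N -> K) : K :=
  \det (\matrix_(i < N, j < N) (u i ^ (lam j + (N - j.+1)%N%:Z))).

Definition vandermonde_prod (K : pzRingType) (u : 'I_N -> K) : K :=
  \prod_(i < N) \prod_(j < N | (i < j)%N) (u i - u j).

Definition schur (lam : 'I_N -> int) : ratfun :=
  alternant lam ratX / vandermonde_prod ratX.

(* The value at [u] of a rational function that is regular at [u], and 0 if it
   is not regular there. By [ratfun_evalE] the value does not depend on the
   representation as a fraction, and by [schur_laurentE] a Schur function is a
   Laurent polynomial, hence regular wherever all the coordinates are nonzero,
   in particular at such points with equal coordinates. *)
Definition ratfun_eval (r : ratfun) (u : 'I_N -> F) : F :=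
  xget 0 [set a | exists p q : mpoly.mpoly N F,
    [/\ meval u q != 0, r = tofrac p / tofrac q & a = meval u p / meval u q]].

Lemma ratfun_evalE (p q : mpoly.mpoly N F) (u : 'I_N -> F) :
  meval u q != 0 ->
  ratfun_eval (tofrac p / tofrac q) u = meval u p / meval u q.
Proof.
have nz (t : mpoly.mpoly N F) : meval u t != 0 -> tofrac t != 0.
  by move=> ht; rewrite tofrac_eq0; apply: contraNneq ht => ->; rewrite rmorph0.
move=> hq; rewrite /ratfun_eval; apply: xget_unique; first by exists p, q.
move=> _ [p' [q' [hq' /eqP hpq ->]]]; apply/eqP.
rewrite eqr_div ?nz // -!rmorphM /= tofrac_eq in hpq.
by rewrite eqr_div // -!rmorphM (eqP hpq).
Qed.

Lemma newton_interp (A : comNzRingType) (u : nat -> A) (p : {poly A}) (m : nat) :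
  exists (c : nat -> A) (r : {poly A}), forall x,
    p.[x] = \sum_(l < m) c l * \prod_(k < l) (x - u k)
            + r.[x] * \prod_(k < m) (x - u k).
Proof.
elim: m => [|m [c [r IH]]].
  by exists (fun=> 0), p => x; rewrite !big_ord0 add0r mulr1.
have /factor_theorem[q hq] : root (r - (r.[u m])%:P) (u m).
  by rewrite /root !hornerE subrr.
exists (fun l => if l == m then r.[u m] else c l), q => x.
have hr : r.[x] = q.[x] * (x - u m) + r.[u m].
  have /(congr1 (fun t => t.[x])) := hq.
  by rewrite !hornerE => <-; rewrite subrK.
rewrite IH !big_ord_recr /= eqxx hr mulrDl.
rewrite -addrA; congr (_ + _); last by rewrite addrC -mulrA (mulrC (x - u m)).
by apply: eq_bigr => l _; rewrite ltn_eqF.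
Qed.

Lemma alternant_dvd (A : comNzRingType) (u : 'I_N -> A) (k : 'I_N -> nat) :
  exists b, \det (\matrix_(i < N, j < N) u i ^+ k j) = b * vandermonde_prod u.
Proof.
pose v l : A := if insub l is Some i then u i else 0.
have vE (i : 'I_N) : v i = u i by rewrite /v valK.
have /choice[c hc] (j : 'I_N) : exists c : nat -> A, forall i : 'I_N,
    u i ^+ k j = \sum_(l < N) c l * \prod_(m < l) (u i - v m).
  have [c [r h]] := newton_interp v 'X^(k j) N.
  exists c => i; have := h (u i); rewrite hornerXn => ->.
  rewrite [X in r.[_] * X](bigD1 i) //= vE.
  by rewrite subrr mul0r mulr0 addr0.
pose L := \matrix_(i < N, l < N) \prod_(m < l) (u i - v m).
pose B := \matrix_(l < N, j < N) c j l.
have -> : \matrix_(i < N, j < N) u i ^+ k j = L *m B.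
  apply/matrixP => i j; rewrite !mxE hc; apply: eq_bigr => l _.
  by rewrite !mxE mulrC.
rewrite det_mulmx det_trig; last first.
  apply/is_trig_mxP => i j ij; rewrite mxE (bigD1 (Ordinal ij)) //= vE.
  by rewrite subrr mul0r.
suff -> : \prod_(i < N) L i i = (\prod_(i < N) (-1) ^+ i) * vandermonde_prod u.
  by exists ((\prod_(i < N) (-1) ^+ i) * \det B); rewrite mulrAC.
rewrite /vandermonde_prod (exchange_big_dep xpredT) //= -big_split /=.
apply: eq_bigr => i _; rewrite mxE.
transitivity (\prod_(m < i) (-1 * (v m - u i))).
  by apply: eq_bigr => m _; rewrite mulN1r opprB.
rewrite big_split /= prodr_const card_ord; congr (_ * _).
rewrite (big_ord_widen N (fun m => v m - u i)) ?(ltnW (ltn_ord i)) //.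
by apply: eq_bigr => m _; rewrite vE.
Qed.

Lemma vandermonde_ratX : vandermonde_prod ratX != 0.
Proof.
apply/prodf_neq0 => i _; apply/prodf_neq0 => j ij.
rewrite subr_eq0 tofrac_eq; apply: contraTneq ij => /(congr1 (mcoeff (mnm1 i))).
rewrite !mcoeffXU eqxx; case: eqVneq => [->|_ /eqP]; first by rewrite ltnn.
by rewrite oner_eq0.
Qed.

Lemma ratX_neq0 (i : 'I_N) : ratX i != 0.
Proof.
rewrite tofrac_eq0; apply/negP => /eqP/(congr1 (mcoeff (mnm1 i)))/eqP.
by rewrite mcoeffXU mcoeff0 eqxx oner_eq0.
Qed.

Lemma alternant_shift (K : fieldType) (lam : 'I_N -> int) (u : 'I_N -> K)
    (m : nat) :
    (forall j, - m%:Z <= lam j) -> (forall i, u i != 0) ->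
  alternant lam u * \prod_(i < N) u i ^+ m =
  \det (\matrix_(i < N, j < N) u i ^+ absz (lam j + m%:Z + (N - j.+1)%N%:Z)).
Proof.
move=> lamm u0; rewrite [X in \det X](_ : _ = diag_mx (\row_i u i ^+ m) *m
    \matrix_(i < N, j < N) (u i ^ (lam j + (N - j.+1)%N%:Z))).
  rewrite det_mulmx det_diag mulrC; congr (_ * _).
  by apply: eq_bigr => i _; rewrite mxE.
rewrite mul_diag_mx; apply/matrixP => i j; rewrite !mxE !exprnP gez0_abs.
  by rewrite -expfzDr // addrCA addrA.
by rewrite addr_ge0 // -lerBlDr sub0r.
Qed.

Lemma schur_laurentE (lam : 'I_N -> int) :
  exists (p : mpoly.mpoly N F) (m : nat),
    schur lam = tofrac p / tofrac (\prod_(i < N) mpolyX F (mnm1 i) ^+ m) /\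
    forall u, (forall i, u i != 0) ->
      meval u p * vandermonde_prod u = alternant lam u * \prod_(i < N) u i ^+ m.
Proof.
pose m := (\sum_(i < N) `|lam i|)%N.
have lamm j : - m%:Z <= lam j.
  suff /ler_normlP[] : `|lam j| <= m%:Z by rewrite lerNl.
  by rewrite -abszE lez_nat /m (bigD1 j) //= leq_addr.
have [p hp] := alternant_dvd (fun i : 'I_N => mpolyX F (mnm1 i))
  (fun j => absz (lam j + m%:Z + (N - j.+1)%N%:Z)).
have vE (S : comNzRingType) (g : {rmorphism mpoly.mpoly N F -> S}) :
    g (vandermonde_prod (fun i : 'I_N => mpolyX F (mnm1 i))) =
    vandermonde_prod (fun i => g (mpolyX F (mnm1 i))).
  rewrite rmorph_prod; apply: eq_bigr => i _; rewrite rmorph_prod.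
  by apply: eq_bigr => j _; rewrite rmorphB.
have gE (S : comNzRingType) (g : {rmorphism mpoly.mpoly N F -> S}) :
    g p * vandermonde_prod (fun i => g (mpolyX F (mnm1 i))) =
    \det (\matrix_(i < N, j < N)
      g (mpolyX F (mnm1 i)) ^+ absz (lam j + m%:Z + (N - j.+1)%N%:Z)).
  rewrite -vE -rmorphM -hp -det_map_mx; congr (\det _).
  by apply/matrixP => i j; rewrite !mxE rmorphXn.
exists p, m; split => [|u u0].
  have -> : tofrac (\prod_(i < N) mpolyX F (mnm1 i) ^+ m) =
      \prod_(i < N) ratX i ^+ m.
    by rewrite rmorph_prod; apply: eq_bigr => i _; rewrite rmorphXn.
  have Xm0 : \prod_(i < N) ratX i ^+ m != 0.
    by apply/prodf_neq0 => i _; rewrite expf_neq0 ?ratX_neq0.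
  have /eqP := alternant_shift lamm ratX_neq0.
  rewrite -(gE _ (@tofrac _)) -(eqr_div _ _ vandermonde_ratX Xm0).
  by move/eqP.
have uE : (fun i => meval u (mpolyX F (mnm1 i))) = u.
  by apply/funext => i; rewrite mevalXU.
rewrite alternant_shift //; have := gE _ (meval u); rewrite uE => ->.
congr (\det _); apply/matrixP => i j; rewrite !mxE; congr (_ ^+ _).
exact: mevalXU.
Qed.

Lemma schur_evalE (lam : 'I_N -> int) (u : 'I_N -> F) :
    (forall i, u i != 0) ->
  ratfun_eval (schur lam) u * vandermonde_prod u = alternant lam u.
Proof.
move=> u0; have [p [m [-> /(_ u u0) hu]]] := schur_laurentE lam.
have mE : meval u (\prod_(i < N) mpolyX F (mnm1 i) ^+ m) = \prod_(i < N) u i ^+ m.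
  by rewrite rmorph_prod; apply: eq_bigr => i _; rewrite (rmorphXn (meval u)); congr (_ ^+ _); exact: mevalXU.
have m0 : \prod_(i < N) u i ^+ m != 0.
  by apply/prodf_neq0 => i _; rewrite expf_neq0.
by rewrite ratfun_evalE mE // mulrAC hu mulfK.
Qed.

End Schur.

(* S_lam(x; N, 1) *)
Definition schur_normalized (F : fieldType) (N : nat) (lam : 'I_N -> int)
    (x : F) : F :=
  ratfun_eval (schur F lam) (fun i : 'I_N => if i == 0%N :> nat then x else 1)
  / ratfun_eval (schur F lam) (fun=> 1).

Section Asymptotics.
Variable R : realType.

Definition cexp (z : R[i]) : R[i] :=
  (expR (complex.Re z))%:C
  * (cos (complex.Im z) +i* sin (complex.Im z)).

Definition R_1 (N : nat) (lam : 'I_N -> int) (f : R -> R) : R :=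
  \sum_(j < N) `|(lam j)%:~R / N%:R - f (j.+1%:R / N%:R)|.

Definition R_infty (N : nat) (lam : 'I_N -> int) (f : R -> R) : R :=
  \big[Num.max/0]_(j < N) `|(lam j)%:~R / N%:R - f (j.+1%:R / N%:R)|.

Definition weakly_decreasing01 (f : R -> R) : Prop :=
  forall x y : R, 0 <= x -> x <= y -> y <= 1 -> f y <= f x.

(* Nothing is required at the break points, nor of the derivative near them. *)
Definition piecewise_differentiable01 (f : R -> R) : Prop :=
  exists breaks : seq R,
    forall x : R, 0 < x < 1 -> x \notin breaks -> derivable f x 1.

Definition Efun (f : R -> R) : R :=
  \int[lebesgue_measure]_(t in `[0, 1]) f t.

Definition Sfun (f : R -> R) : R :=
  \int[lebesgue_measure]_(t in `[0, 1]) (f t ^+ 2) - Efun f ^+ 2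
  + \int[lebesgue_measure]_(t in `[0, 1]) (f t * (1 - 2 * t)).

End Asymptotics.

(* Main.v *)
(* With [l_j = lam_j + N - j], [S_lam(x)] times [(x - 1)^(N-1) / (N-1)!] is the
   divided difference of [t |-> x^t] at the points [l_j], and [(x - 1)^(N-1)] is
   the same object for [lam = 0].  Put [x = exp(h / sqrt N)], subtract from the
   [l_j] their mean, and set [z_j = h (l_j - mean) / N^(3/2)]: expanding the
   exponential, the divided difference becomes
     [sum_k (N-1)! N^k / (N-1+k)! * h_k(z)],
   with [h_k] the complete homogeneous symmetric functions.  The power sums satisfy
   [p_1 = 0], [p_2 = O(1)] and [p_m = O(N^(1-m/2))], so that Newton's identity
   makes [h_k(z)] geometrically small in [k], with the coefficients of
   [exp(p_2 t^2 / 2)] as limits.  Hence the divided difference is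
   [exp(p_2 / 2) + O(N^(-1/2))], and the quotient of the two cases [lam] and [0]
   gives the theorem: [S(f)] is the variance of [f(t) + 1 - t] minus that of
   [1 - t], and all bounds are uniform for bounded [h]. *)
Require Import Defs.
From HB Require Import structures.
From mathcomp Require Import all_boot all_order all_algebra.
From mathcomp Require Import all_classical all_reals all_analysis.
From mathcomp Require Import measurable_realfun fraction complex ring lra.
From mathcomp Require Import -(notations) mpoly.

Import Order.TTheory GRing.Theory Num.Theory numFieldNormedType.Exports.

Local Open Scope classical_set_scope.
Local Open Scope ring_scope.
Local Open Scope complex_scope.

(** * Divided differences and complete homogeneous sums *)

(** With repeated ones among the arguments, the quotient of alternants reads 0/0. No limit is taken:
    the identity between alternant and numerator lives in the polynomial ring and is specialised to
    rings where the Vandermonde product is nonzero. It gives [P (X - 1)^n = sum_j c_j X^(k_j)], and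
    a zero of order [n] at 1 fixes the [n + 1] coefficients up to a common factor, which the
    normalisation by the value at [1^N] removes. Centering is forced by the mean, whose contribution
    [sqrt N E(f) h] to the exponent is unbounded. It is factored out exactly, so that an error
    [o(N^(-1/2))] in the mean is affordable; this is what [R_1 = o(sqrt N)] provides. The bound on
    [R_infty] keeps the centered positions bounded, hence all power sums under control at once. The
    remainder is a logarithm of the quotient of [S_lam] by the claimed main term. For large [N] that
    quotient lies close to 1, so no branch has to be followed. *)

(* [symh s k] is the complete homogeneous sum [h_k(s)]: prepending [w] to [s]
   multiplies the generating series by [1 / (1 - w t)]. *)
Definition symh_step (F : pzRingType) (w : F) (h : nat -> F) (k : nat) : F :=
  \sum_(i < k.+1) w ^+ i * h (k - i)%N.

Fixpoint symh (F : pzRingType) (s : seq F) : nat -> F :=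
  if s is w :: s' then symh_step F w (symh F s') else fun k => (k == 0%N)%:R.

Arguments symh : simpl never.

Lemma symh_nil (F : pzRingType) (k : nat) : symh F [::] k = (k == 0%N)%:R.
Proof. by []. Qed.

Lemma symh_cons (F : pzRingType) (w : F) (s : seq F) (k : nat) :
  symh F (w :: s) k = \sum_(i < k.+1) w ^+ i * symh F s (k - i)%N.
Proof. by []. Qed.

Definition powsum (F : pzRingType) (s : seq F) (m : nat) : F :=
  \sum_(x <- s) x ^+ m.

Definition divdiff (F : fieldType) (s : seq F) (g : F -> F) : F :=
  \sum_(x <- s) g x / \prod_(y <- s | y != x) (x - y).

Lemma symh_cons0 (F : pzRingType) (w : F) (s : seq F) :
  symh F (w :: s) 0 = symh F s 0.
Proof. by rewrite symh_cons big_ord1 expr0 mul1r. Qed.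

Lemma symh0 (F : pzRingType) (s : seq F) : symh F s 0 = 1.
Proof. by elim: s => [|w s IH]; rewrite ?symh_nil ?symh_cons0. Qed.

Lemma symh_consS (F : pzRingType) (w : F) (s : seq F) (k : nat) :
  symh F (w :: s) k.+1 = symh F s k.+1 + w * symh F (w :: s) k.
Proof.
rewrite symh_cons big_ord_recl expr0 mul1r subn0 mulr_sumr; congr (_ + _).
by apply: eq_bigr => i _; rewrite lift0 exprS mulrA subSS.
Qed.

Lemma symh_scale (F : comPzRingType) (c : F) (s : seq F) (k : nat) :
  symh F [seq c * x | x <- s] k = c ^+ k * symh F s k.
Proof.
elim: s k => [|w s IH] k.
  by case: k => [|k]; rewrite /= !symh_nil ?expr0 ?mulr1 ?mulr0.
rewrite symh_cons mulr_sumr; apply: eq_bigr => i _.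
by rewrite IH exprMn mulrACA -exprD subnKC ?leq_ord.
Qed.

(** Induction on [s], then on [k]: [symh_consS] replaces each [h_(j+1)(w :: s)] by
    [h_(j+1)(s) + w h_j(w :: s)]. The second parts form the identity at [k], the first ones that of
    [s] plus one more copy of [w h_k(w :: s)]. *)
Lemma symh_newton (F : comPzRingType) (s : seq F) (k : nat) :
  k%:R * symh F s k = \sum_(m < k) powsum F s m.+1 * symh F s (k - m.+1)%N.
Proof.
elim: s k => [|w s IHs] k.
  rewrite big1 => [|m _]; last by rewrite /powsum big_nil mul0r.
  by case: k => [|k]; rewrite symh_nil ?mul0r ?mulr0.
elim: k => [|k IHk]; first by rewrite big_ord0 mul0r.
have pE m : powsum F (w :: s) m = w ^+ m + powsum F s m by rewrite /powsum big_cons.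
have -> : \sum_(m < k.+1) powsum F (w :: s) m.+1 * symh F (w :: s) (k.+1 - m.+1)%N
  = \sum_(m < k.+1) powsum F (w :: s) m.+1 * symh F s (k - m)%N
    + w * \sum_(m < k) powsum F (w :: s) m.+1 * symh F (w :: s) (k - m.+1)%N.
  rewrite !big_ord_recr /= subSS subnn symh_cons0 addrAC; congr (_ + _).
  rewrite mulr_sumr -big_split /=; apply: eq_bigr => m _.
  rewrite subSS -[(k - m)%N](prednK _) ?subn_gt0 // symh_consS mulrDr subnS.
  by congr (_ + _); rewrite mulrCA.
under eq_bigr do rewrite pE mulrDl.
rewrite big_split /= -IHk symh_consS mulrDr IHs.
under [in LHS]eq_bigr do rewrite subSS.
rewrite [RHS]addrAC addrC; congr (_ + _).
have -> : \sum_(i < k.+1) w ^+ i.+1 * symh F s (k - i)%N = w * symh F (w :: s) k.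
  by rewrite symh_cons mulr_sumr; apply: eq_bigr => i _; rewrite exprS mulrA.
by rewrite mulrCA -mulrDr -[X in X + _]mul1r -mulrDl -natr1 addrC.
Qed.

Lemma divdiff_sum (F : fieldType) (s : seq F) (n : nat) (g : nat -> F -> F) :
  divdiff F s (fun x => \sum_(i < n) g i x) = \sum_(i < n) divdiff F s (g i).
Proof.
rewrite /divdiff exchange_big /=; apply: eq_bigr => x _.
by rewrite mulr_suml.
Qed.

Lemma divdiffZ (F : fieldType) (s : seq F) (c : F) (g : F -> F) :
  divdiff F s (fun x => c * g x) = c * divdiff F s g.
Proof. by rewrite /divdiff mulr_sumr; apply: eq_bigr => x _; rewrite mulrA. Qed.

Lemma divdiffB (F : fieldType) (s : seq F) (g1 g2 : F -> F) :
  divdiff F s (fun x => g1 x - g2 x) = divdiff F s g1 - divdiff F s g2.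
Proof. by rewrite /divdiff -sumrB; apply: eq_bigr => x _; rewrite mulrBl. Qed.

Lemma eq_divdiff (F : fieldType) (s : seq F) (g1 g2 : F -> F) :
  g1 =1 g2 -> divdiff F s g1 = divdiff F s g2.
Proof. by move=> e; apply: eq_bigr => x _; rewrite e. Qed.

Lemma perm_divdiff (F : fieldType) (s1 s2 : seq F) (g : F -> F) :
  perm_eq s1 s2 -> divdiff F s1 g = divdiff F s2 g.
Proof.
move=> e; rewrite /divdiff (perm_big _ e); apply: eq_bigr => x _.
by rewrite (perm_big _ e).
Qed.

Lemma divdiff_cons (F : fieldType) (w : F) (s : seq F) (g : F -> F) :
  uniq (w :: s) -> divdiff F (w :: s) (fun x => g x * (x - w)) = divdiff F s g.
Proof.
rewrite /= => /andP[ws _].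
rewrite /divdiff big_cons subrr mulr0 mul0r add0r.
apply: eq_big_seq => x xs; rewrite big_cons.
have wx : w != x by apply: contraNneq ws => ->.
by rewrite wx invfM mulrA mulfK // subr_eq0 eq_sym.
Qed.

Lemma divdiff_expS (F : fieldType) (w : F) (s : seq F) (k : nat) :
  uniq (w :: s) ->
  divdiff F (w :: s) (fun x => x ^+ k.+1) =
  divdiff F s (fun x => x ^+ k) + w * divdiff F (w :: s) (fun x => x ^+ k).
Proof.
move=> u; rewrite -(divdiff_cons _ _ _ (fun x => x ^+ k) u) -divdiffZ.
apply/eqP; rewrite -subr_eq -divdiffB; apply/eqP/eq_divdiff => x.
by rewrite mulrBr exprSr (mulrC w).
Qed.

(** By induction the divided differences of [x - w] and of [x - v] vanish, each being that of 1 with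
    a node removed. Their difference is the constant [v - w], which is nonzero. *)
Lemma divdiff1 (F : fieldType) (w v : F) (s : seq F) :
  uniq [:: w, v & s] -> divdiff F [:: w, v & s] (fun=> 1) = 0.
Proof.
elim: s w v => [|t s IH] w v u.
  move: u; rewrite /= inE andbT => wv.
  rewrite /divdiff !big_cons !big_nil !eqxx (eq_sym v) wv /= !mulr1 !mul1r.
  by rewrite -[v - w]opprB invrN addr0 subrr.
have pe : perm_eq [:: v, w, t & s] [:: w, v, t & s].
  exact: permEl (perm_catCA [:: v] [:: w] _).
have uv : uniq [:: v, w, t & s] by rewrite (perm_uniq pe).
have := divdiff_cons _ _ _ (fun=> 1) uv.
rewrite (perm_divdiff _ _ _ _ pe).
rewrite IH; last by case/andP: uv.
have := divdiff_cons _ _ _ (fun=> 1) u; rewrite IH; last by case/andP: u.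
move=> e1 e2.
have : (v - w) * divdiff F [:: w, v, t & s] (fun=> 1) = 0.
  rewrite -divdiffZ -[RHS](subrr 0) -{1}e1 -e2 -divdiffB; apply: eq_divdiff => x.
  by rewrite !mul1r mulr1 opprB addrCA addrAC subrr add0r.
move/eqP; rewrite mulf_eq0 subr_eq0 => /orP[/eqP vw|/eqP //].
by move: u; rewrite vw /= inE eqxx.
Qed.

Lemma divdiff_exp_small (F : fieldType) (s : seq F) (k : nat) :
  uniq s -> (k.+1 < size s)%N -> divdiff F s (fun x => x ^+ k) = 0.
Proof.
elim: k s => [|k IH] [|w [|v s]] // u ks.
  by rewrite -(divdiff1 _ _ _ _ u); apply: eq_divdiff => x; rewrite expr0.
rewrite divdiff_expS // IH ?add0r; last by rewrite ltnS.
- by rewrite IH ?mulr0 // ltnW.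
- by case/andP: u.
Qed.

(** Both sides obey the same recursion in [k] and in the nodes: [divdiff_expS] on the left,
    [symh_consS] on the right. *)
Lemma divdiff_exp (F : fieldType) (s : seq F) (k : nat) :
  uniq s -> (0 < size s)%N ->
  divdiff F s (fun x => x ^+ (k + (size s).-1)) = symh F s k.
Proof.
elim: s k => [|w s IH] // k u _ /=.
have us : uniq s by case/andP: u.
have [s0|s0] := posnP (size s).
  move/size0nil: s0 => s0; rewrite {}s0 {IH us} in u *.
  rewrite /divdiff big_cons !big_nil /= addn0 addr0 big_cons eqxx big_nil divr1.
  rewrite symh_cons big_ord_recr /= subnn symh_nil mulr1 big1 ?add0r // => i _.
  by rewrite symh_nil subn_eq0 leqNgt ltn_ord mulr0.
have IH' j : divdiff F s (fun x => x ^+ (j + (size s).-1)) = symh F s j by exact: IH.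
elim: k => [|k IHk].
  rewrite add0n -[in LHS](prednK s0) divdiff_expS //.
  rewrite (divdiff_exp_small _ (w :: s)) ?mulr0 ?addr0 //; last by rewrite /= prednK.
  by rewrite -[(size s).-1]add0n IH' !symh0.
rewrite addSn divdiff_expS // IHk symh_consS; congr (_ + _).
by rewrite -IH' -[in LHS](prednK s0) addnS addSn.
Qed.

(** * Schur functions at (x, 1, ..., 1) *)

(* [x d/dx - a], which acts on ['X^k] as the scalar [k - a] and lowers the
   order of vanishing at 1 by one. *)
Definition theta (F : fieldType) (a : F) (G : {poly F}) : {poly F} :=
  'X * G^`() - a *: G.

Lemma theta_sum (F : fieldType) (I : finType) (s : seq F) (c : I -> F)
    (k : I -> nat) :
  foldr (theta F) (\sum_j c j *: 'X^(k j)) s =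
  \sum_j (c j * \prod_(a <- s) ((k j)%:R - a)) *: 'X^(k j).
Proof.
elim: s => [|a s IH] /=.
  by apply: eq_bigr => j _; rewrite big_nil mulr1.
rewrite IH /theta raddf_sum mulr_sumr scaler_sumr -sumrB.
apply: eq_bigr => j _; rewrite big_cons /= derivZ derivXn.
set A := c j * _.
have -> : 'X * (A *: ('X^((k j).-1) *+ k j)) = (A * (k j)%:R) *: 'X^(k j).
  rewrite -scalerAr -scalerA scaler_nat; congr (_ *: _).
  by case: (k j) => [|m]; rewrite ?mulr0n ?mulr0 // mulrnAr -exprS.
by rewrite scalerA -scalerBl /A; congr (_ *: _); ring.
Qed.

(** On a zero of order [m] at 1 the derivative multiplies the leading value by [m], while the term
    with [a] still has order [m] and disappears from it. Hence a falling factorial, whatever the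
    shifts in [s]. *)
Lemma theta_vanish (F : fieldType) (s : seq F) (P : {poly F}) (r : nat) :
  exists2 Q : {poly F}, foldr (theta F) (P * ('X - 1) ^+ (size s + r)) s
      = Q * ('X - 1) ^+ r
    & Q.[1] = ((size s + r) ^_ (size s))%:R * P.[1].
Proof.
elim: s r => [|a s IH] r /=; first by exists P; rewrite ?ffactn0 ?mul1r.
have [Q eQ Q1] := IH r.+1; rewrite addSnnS eQ /theta.
exists ('X * (Q^`() * ('X - 1) + Q *+ r.+1) - a *: (Q * ('X - 1))).
  rewrite derivM deriv_exp derivB derivX derivC subr0 mul1r -!mul_polyC mulrnAr.
  by rewrite -mulrnAl /= exprS; move: (Q *+ r.+1) => T; ring.
rewrite !(hornerE, hornerMn) subrr /= !(mulr0, subr0, add0r, mul1r) Q1.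
by rewrite -mulr_natr ffactnSr natrM addKn mulrAC.
Qed.

(** The operators with [a = k i], [i != j], kill every monomial except [X^(k j)]. Evaluated at 1,
    the sum leaves its [j]-th coefficient times the product, and the product [P (X - 1)^n] leaves
    [n! P(1)]. *)
Lemma coef_order_at1 (F : fieldType) (n : nat) (c : 'I_n.+1 -> F)
    (k : 'I_n.+1 -> nat) (P : {poly F}) :
  P * ('X - 1) ^+ n = \sum_j c j *: 'X^(k j) ->
  forall j, c j * \prod_(i | i != j) ((k j)%:R - (k i)%:R) = n`!%:R * P.[1].
Proof.
move=> e j; pose s : seq F := [seq (k i)%:R | i <- enum (predC1 j)].
have ss : size s = n by rewrite size_map -cardE cardC1 card_ord.
have [Q] := theta_vanish F s P 0.
rewrite addn0 ss ffactnn e theta_sum expr0 mulr1 => eQ <-.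
rewrite -eQ horner_sum [RHS](bigD1 j) //= [X in _ + X]big1 ?addr0 => [|i ij].
  by rewrite hornerZ hornerXn expr1n mulr1 big_map big_enum.
rewrite (_ : \prod_(a <- s) _ = 0) ?mulr0 ?scale0r ?horner0 //.
rewrite big_map big_enum /= (bigD1 i) //=; first by rewrite subrr mul0r.
Qed.

Lemma rmorph_mmap (F : nzRingType) (S T : comNzRingType) (N : nat)
    (f : {rmorphism F -> S}) (g : {rmorphism S -> T}) (h : 'I_N -> S)
    (p : mpoly.mpoly N F) :
  g (mmap f h p) = mmap (g \o f) (g \o h) p.
Proof.
rewrite /mmap rmorph_sum; apply: eq_bigr => m _.
rewrite rmorphM /mmap1 rmorph_prod; congr (_ * _).
by apply: eq_bigr => i _; rewrite rmorphXn.
Qed.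

Lemma vandermonde_prodS (A : comNzRingType) (n : nat) (u : 'I_n.+1 -> A) :
  vandermonde_prod u = (\prod_(i < n) (u ord0 - u (lift ord0 i))) *
    vandermonde_prod (fun i : 'I_n => u (lift ord0 i)).
Proof.
rewrite /vandermonde_prod big_ord_recl; congr (_ * _).
  by rewrite big_mkcond big_ord_recl /= mul1r; apply: eq_bigr.
apply: eq_bigr => i _; rewrite big_mkcond big_ord_recl /= mul1r.
by rewrite [RHS]big_mkcond; apply: eq_bigr => j _.
Qed.

Lemma rmorph_vandermonde (A B : comNzRingType) (g : {rmorphism A -> B})
    (N : nat) (u : 'I_N -> A) :
  g (vandermonde_prod u) = vandermonde_prod (g \o u).
Proof.
rewrite rmorph_prod; apply: eq_bigr => i _; rewrite rmorph_prod.
by apply: eq_bigr => j _; rewrite rmorphB.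
Qed.

Lemma vandermonde_neq0 (A : idomainType) (N : nat) (u : 'I_N -> A) :
  injective u -> vandermonde_prod u != 0.
Proof.
move=> iu; apply/prodf_neq0 => i _; apply/prodf_neq0 => j ij.
by rewrite subr_eq0; apply: contraTneq ij => /iu ->; rewrite ltnn.
Qed.

Section SchurPoly.
Variables (F : fieldType) (n : nat) (k : 'I_n.+1 -> nat).
Variable p : mpoly.mpoly n.+1 F.
Hypothesis detE : \det (\matrix_(i < n.+1, j < n.+1) mpolyX F (mnm1 i) ^+ k j)
  = p * vandermonde_prod (fun i => mpolyX F (mnm1 i)).

(** The identity for [p] may be specialised in any commutative ring. Polynomial rings serve as
    deformations of points where the Vandermonde product vanishes. *)
Lemma mmap_detE (S : comNzRingType) (f : {rmorphism F -> S}) (u : 'I_n.+1 -> S) :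
  \det (\matrix_(i < n.+1, j < n.+1) u i ^+ k j) = mmap f u p * vandermonde_prod u.
Proof.
have Xu i : mmap f u (mpolyX F (mnm1 i)) = u i by rewrite mmapX mmap1U.
have /(congr1 (mmap f u)) := detE.
rewrite rmorphM rmorph_vandermonde -det_map_mx.
have -> : mmap f u \o (fun i => mpolyX F (mnm1 i)) = u by apply/funext => i /=.
by move=> <-; congr (\det _); apply/matrixP => i j; rewrite !mxE rmorphXn /= Xu.
Qed.

(* The cofactors of the first row of the alternant are divisible by the
   Vandermonde product of the other variables, which are then all set to 1. *)
Lemma schur_poly1 :
  exists (P : {poly F}) (c : 'I_n.+1 -> F),
    (forall x, P.[x] = meval (fun i : 'I_n.+1 => if i == 0%N :> nat then x else 1) p)
    /\ P * ('X - 1) ^+ n = \sum_j c j *: 'X^(k j).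
Proof.
(* The outer variable stands for [x], the inner one is a deformation parameter [t]. The values
   [1 + t^(i+1)] are pairwise distinct over any field, so their Vandermonde product cancels, and all
   become 1 at [t = 0]; the exponent starts at 1 for this reason. *)
pose u' (i : 'I_n) : {poly F} := 1 + 'X^(i.+1).
pose u (i : 'I_n.+1) : {poly {poly F}} :=
  if unlift ord0 i is Some j then (u' j)%:P else 'X.
have u0 : u ord0 = 'X by rewrite /u unlift_none.
have uS i : u (lift ord0 i) = (u' i)%:P by rewrite /u liftK.
have /choice[b hb] (j : 'I_n.+1) := alternant_dvd u' (fun l => k (lift j l)).
pose p1 := mmap (polyC \o polyC) u p.
have cofE j : cofactor (\matrix_(i < n.+1, j < n.+1) u i ^+ k j) ord0 j =
    ((-1) ^+ j * b j * vandermonde_prod u')%:P.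
  rewrite -mulrA -hb polyCM rmorphXn rmorphN rmorph1 /cofactor add0n.
  congr (_ * _); rewrite -det_map_mx; congr (\det _); apply/matrixP => i l.
  by rewrite !mxE uS rmorphXn.
have e1 : p1 * \prod_(i < n) ('X - (u' i)%:P) =
    \sum_(j < n.+1) ((-1) ^+ j * b j) *: 'X^(k j).
  have V0 : (vandermonde_prod u')%:P != 0.
    rewrite polyC_eq0 vandermonde_neq0 // => i j /addrI e.
    by apply/val_inj; have := congr1 (fun q : {poly F} => size q) e;
      rewrite !size_polyXn => -[].
  apply: (mulIf V0); have := mmap_detE _ (polyC \o polyC) u.
  rewrite vandermonde_prodS (expand_det_row _ ord0) -/p1 u0 mulrA.
  have -> : vandermonde_prod (fun i : 'I_n => u (lift ord0 i)) =
      (vandermonde_prod u')%:P.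
    rewrite [RHS]rmorph_vandermonde; congr vandermonde_prod.
    by apply/funext => i /=.
  under [X in _ = _ * X * _ -> _]eq_bigr do rewrite uS.
  move=> <-; rewrite mulr_suml; apply: eq_bigr => j _.
  by rewrite cofE mxE u0 -mul_polyC polyCM mulrC mulrAC.
(* Sets the deformation parameter to 0, coefficient by coefficient. *)
pose ev : {rmorphism {poly {poly F}} -> {poly F}} := map_poly (horner_eval (0 : F)).
have evC q : ev q%:P = (q.[0])%:P by rewrite /= map_polyC.
have evX : ev 'X = 'X by exact: map_polyX.
exists (ev p1), (fun j : 'I_n.+1 => (-1) ^+ j * (b j).[0]); split => [x|].
  rewrite -[LHS]/(horner_eval x (ev p1)).
  rewrite /p1 [X in horner_eval x X]rmorph_mmap rmorph_mmap.
  rewrite /meval; congr mmap; apply/funext => i.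
    by rewrite -[LHS]/((ev i%:P%:P).[x]) evC !hornerC.
  rewrite -[LHS]/((ev (u i)).[x]); case: (unliftP ord0 i) => [j|] ->.
    by rewrite uS evC hornerC /u' !hornerE expr0n /= addr0.
  by rewrite u0 evX hornerX.
have /(congr1 ev) := e1; rewrite rmorphM rmorph_prod.
have -> : \prod_(i < n) ev ('X - (u' i)%:P) = ('X - 1) ^+ n.
  rewrite -[n in RHS]card_ord -prodr_const; apply: eq_bigr => i _.
  by rewrite rmorphB evX evC /u' !hornerE expr0n /= addr0.
move=> ->; rewrite rmorph_sum; apply: eq_bigr => j _.
rewrite /= map_polyZ map_polyXn; congr (_ *: _).
by rewrite rmorphM rmorphXn rmorphN rmorph1.
Qed.

(* Substituting ['X^i] for the [i]-th variable turns the alternant into a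
   Vandermonde determinant. *)
Lemma schur_poly_neq0 : (forall i j, (k i)%:R = (k j)%:R :> F -> i = j) ->
  meval (fun=> 1) p != 0.
Proof.
move=> ik; pose u (i : 'I_n.+1) : {poly F} := 'X^i.
(* [g a] is [(X^a - 1) / (X - 1)]. Both products then carry the same power of [X - 1]; once it is
   cancelled, evaluation at 1 leaves differences of the [k j] on one side and of the indices on the
   other, as in Weyl's dimension formula. *)
pose g a : {poly F} := \sum_(i < a) 'X^i.
have gE a b : 'X^a - 'X^b = ('X - 1) * (g a - g b) :> {poly F}.
  by rewrite mulrBr -!subrX1 opprB addrA subrK.
have g1 a : (g a).[1] = a%:R.
  rewrite /g horner_sum (eq_bigr (fun=> 1)) => [|i _]; last by rewrite hornerXn expr1n.
  by rewrite sumr_const card_ord.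
have := mmap_detE _ polyC u.
have -> : \det (\matrix_(i < n.+1, j < n.+1) u i ^+ k j) =
    \prod_(i < n.+1) \prod_(j < n.+1 | (i < j)%N) ('X^(k j) - 'X^(k i)).
  transitivity (\det (Vandermonde n.+1 (\row_j 'X^(k j) : 'rV[{poly F}]_n.+1))).
    by congr (\det _); apply/matrixP => i j; rewrite !mxE -!exprM mulnC.
  rewrite det_Vandermonde; apply: eq_bigr => i _; apply: eq_bigr => j _.
  by rewrite !mxE.
have spl (c : 'I_n.+1 -> 'I_n.+1 -> {poly F}) :
    \prod_(i < n.+1) \prod_(j < n.+1 | (i < j)%N) (('X - 1) * c i j) =
    (\prod_(i < n.+1) \prod_(j < n.+1 | (i < j)%N) ('X - 1)) *
    (\prod_(i < n.+1) \prod_(j < n.+1 | (i < j)%N) c i j).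
  by rewrite -big_split; apply: eq_bigr => i _; rewrite -big_split.
rewrite /vandermonde_prod; under eq_bigr do under eq_bigr do rewrite gE.
under [in RHS]eq_bigr do under eq_bigr do rewrite /u gE.
rewrite !spl // mulrCA => /mulfI e.
have /e/(congr1 (horner_eval (1 : F))) :
    \prod_(i < n.+1) \prod_(j < n.+1 | (i < j)%N) ('X - 1) != 0 :> {poly F}.
  apply/prodf_neq0 => i _; apply/prodf_neq0 => j _.
  by rewrite -[1]/(1%:P) polyXsubC_eq0.
rewrite rmorphM rmorph_mmap.
have -> : mmap (horner_eval (1 : F) \o polyC) (horner_eval 1 \o u) p = meval (fun=> 1) p.
  rewrite /meval; congr mmap; apply/funext => i /=; rewrite /horner_eval ?hornerC //.
  by rewrite hornerXn expr1n.
move=> e'; apply/eqP => p0; move: e'; rewrite p0 mul0r => /eqP.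
rewrite rmorph_prod; apply/negP/prodf_neq0 => i _; rewrite rmorph_prod.
apply/prodf_neq0 => j ij; rewrite /= /horner_eval hornerD hornerN !g1 subr_eq0.
by apply: contraTneq ij => /ik ->; rewrite ltnn.
Qed.

End SchurPoly.

(** [schur_laurentE] ties the values of the numerator to the alternant only up to the Vandermonde
    product, hence says nothing where it vanishes. Here the relation is kept between polynomials, in
    the form required by [schur_poly1] and [schur_poly_neq0]. *)
Lemma schur_mpoly (F : fieldType) (N : nat) (lam : 'I_N -> int) :
  exists (p : mpoly.mpoly N F) (m : nat),
    let l j : int := lam j + m%:Z + (N - j.+1)%N%:Z in
    [/\ forall j, 0 <= l j,
      \det (\matrix_(i < N, j < N) mpolyX F (mnm1 i) ^+ absz (l j))
        = p * vandermonde_prod (fun i => mpolyX F (mnm1 i))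
    & forall u, (forall i, u i != 0) ->
      ratfun_eval (schur F lam) u = meval u p / \prod_(i < N) u i ^+ m].
Proof.
pose m := (\sum_(i < N) `|lam i|)%N.
have lamm j : - m%:Z <= lam j.
  suff /ler_normlP[] : `|lam j| <= m%:Z by rewrite lerNl.
  by rewrite -abszE lez_nat /m (bigD1 j) //= leq_addr.
pose l j : int := lam j + m%:Z + (N - j.+1)%N%:Z.
have [p hp] := alternant_dvd (fun i : 'I_N => mpolyX F (mnm1 i)) (fun j => absz (l j)).
exists p, m; split => //.
  by move=> j; rewrite addr_ge0 // -lerBlDr sub0r.
move=> u u0; pose d := \prod_(i < N) mpolyX F (mnm1 i) ^+ m.
have dE : meval u d = \prod_(i < N) u i ^+ m.
  rewrite rmorph_prod; apply: eq_bigr => i _; rewrite (rmorphXn (meval u)).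
  by congr (_ ^+ _); exact: mevalXU.
have d0 : \prod_(i < N) u i ^+ m != 0.
  by apply/prodf_neq0 => i _; rewrite expf_neq0.
have rd : tofrac d = \prod_(i < N) ratX F i ^+ m.
  by rewrite rmorph_prod; apply: eq_bigr => i _; rewrite rmorphXn.
have Xm0 : \prod_(i < N) ratX F i ^+ m != 0.
  by apply/prodf_neq0 => i _; rewrite expf_neq0 ?ratX_neq0.
suff -> : schur F lam = tofrac p / tofrac d by rewrite ratfun_evalE dE.
apply/eqP; rewrite /schur rd eqr_div ?vandermonde_ratX //.
rewrite (alternant_shift lamm (@ratX_neq0 F N)).
have -> : vandermonde_prod (ratX F (N := N)) =
    tofrac (vandermonde_prod (fun i : 'I_N => mpolyX F (mnm1 i))).
  by rewrite rmorph_vandermonde.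
rewrite -rmorphM /= -hp -det_map_mx; apply/eqP; congr (\det _).
by apply/matrixP => i j; rewrite !mxE rmorphXn.
Qed.

Lemma horner_order_at1 (F : numFieldType) (n : nat) (c : 'I_n.+1 -> F)
    (k : 'I_n.+1 -> nat) (P : {poly F}) (x : F) :
  injective k -> P * ('X - 1) ^+ n = \sum_j c j *: 'X^(k j) ->
  P.[x] * (x - 1) ^+ n = n`!%:R * P.[1] *
    \sum_j x ^+ k j / \prod_(i | i != j) ((k j)%:R - (k i)%:R).
Proof.
move=> ik e; have cE := coef_order_at1 _ _ _ _ _ e.
have /(congr1 (horner_eval x)) := e.
rewrite /horner_eval hornerM horner_exp hornerD hornerX hornerN hornerC => ->.
rewrite horner_sum mulr_sumr; apply: eq_bigr => j _.
have D0 : \prod_(i | i != j) ((k j)%:R - (k i)%:R) != 0 :> F.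
  apply/prodf_neq0 => i ij; rewrite subr_eq0 eqr_nat.
  by apply: contraNneq ij => /ik ->.
by rewrite hornerZ hornerXn -(cE j) mulrACA divff // mulr1 mulrC.
Qed.

Definition shifted (n : nat) (lam : 'I_n -> int) (j : 'I_n) : int :=
  lam j + (n - j.+1)%N%:Z.

Lemma shifted_inj (n : nat) (lam : 'I_n -> int) :
  signature lam -> injective (shifted n lam).
Proof.
move=> hl; suff lt (i j : 'I_n) : (i < j)%N -> shifted n lam j < shifted n lam i.
  move=> i j e; apply/val_inj/eqP; case: ltngtP => // /lt; by rewrite e ltxx.
move=> ij; rewrite /shifted ler_ltD ?hl 1?ltnW // ltz_nat.
by rewrite ltn_sub2l // (leq_ltn_trans _ (ltn_ord j)).
Qed.

(** The case [P = 1] of [horner_order_at1], with the binomial expansion on the right. The exponents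
    are listed in decreasing order so as to be those of [shifted] at the zero signature. *)
Lemma vandermonde_expansion (F : numFieldType) (n : nat) (x : F) :
  (x - 1) ^+ n = n`!%:R *
    \sum_(j < n.+1) x ^ (n.+1 - j.+1)%N%:Z /
      \prod_(i < n.+1 | i != j) ((n.+1 - j.+1)%N%:~R - (n.+1 - i.+1)%N%:~R).
Proof.
pose k (j : 'I_n.+1) : nat := (n.+1 - j.+1)%N.
have ik : injective k.
  by move=> i j e; apply/rev_ord_inj/val_inj.
have := horner_order_at1 F n (fun j => (('X - 1) ^+ n)`_(k j)) k 1 x ik.
rewrite !hornerC !mul1r mulr1 => -> //.
rewrite (reindex_inj rev_ord_inj) /=.
have sz : (size (('X - 1) ^+ n : {poly F}) <= n.+1)%N.
  by rewrite -[1]/(1%:P) size_exp_XsubC.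
rewrite -{1}(coefK (('X - 1) ^+ n)) poly_def.
rewrite (big_ord_widen _ (fun i => (('X - 1) ^+ n)`_i *: 'X^i) sz).
rewrite big_mkcond; apply: eq_bigr => i _.
have -> : k (rev_ord i) = i by rewrite /k /= !subSS subKn ?leq_ord.
by case: ltnP => // h; rewrite nth_default ?scale0r.
Qed.

(** The factor [P(1)] cancels by normalisation, and the shift [m] that clears negative exponents
    cancels from [x^m] and from all differences. The value at 1 is a separate clause because for
    [n > 0] the first one degenerates there to [0 = 0]. *)
Lemma schur_normalized_expansion (F : numFieldType) (n : nat)
    (lam : 'I_n.+1 -> int) (x : F) :
  signature lam -> x != 0 ->
  schur_normalized lam x * (x - 1) ^+ n = n`!%:R *
    \sum_j x ^ shifted n.+1 lam j /
      \prod_(i | i != j) ((shifted n.+1 lam j)%:~R - (shifted n.+1 lam i)%:~R)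
  /\ schur_normalized lam (1 : F) = 1.
Proof.
move=> hl x0; have [p [m [l0 detE evE]]] := schur_mpoly F n.+1 lam.
pose l (j : 'I_n.+1) : int := lam j + m%:Z + (n.+1 - j.+1)%N%:Z.
have {}l0 j : 0 <= l j by exact: l0.
have {}detE : \det (\matrix_(i < n.+1, j < n.+1) mpolyX F (mnm1 i) ^+ absz (l j))
  = p * vandermonde_prod (fun i => mpolyX F (mnm1 i)) by exact: detE.
have lE j : l j = shifted n.+1 lam j + m%:Z by rewrite /l /shifted addrAC.
have kE j : (absz (l j))%:R = (l j)%:~R :> F by rewrite -[in RHS](gez0_abs (l0 j)).
have ik : injective (fun j => absz (l j)).
  move=> i j /(congr1 Posz); rewrite !gez0_abs // !lE => /addIr.
  exact: shifted_inj.
have [P [c [PE Pc]]] := schur_poly1 _ _ _ _ detE.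
have P1 : P.[1] != 0.
  rewrite PE (_ : meval _ p = meval (fun=> 1) p); last first.
    by apply: meval_eq => i; case: ifP.
  apply: (schur_poly_neq0 _ _ _ _ detE) => i j /eqP.
  by rewrite eqr_nat => /eqP /ik.
have evP y : y != 0 -> ratfun_eval (schur F lam)
    (fun i : 'I_n.+1 => if i == 0%N :> nat then y else 1) = P.[y] / y ^+ m.
  move=> y0; rewrite evE => [|i]; last by case: ifP; rewrite ?oner_eq0.
  rewrite PE; congr (_ / _); rewrite big_ord_recl /= big1 ?mulr1 // => i _.
  by rewrite expr1n.
have ev1 : ratfun_eval (schur F lam) (fun=> 1) = P.[1].
  rewrite -[RHS]divr1 -[X in _ / X](expr1n F m) -evP ?oner_eq0 //; congr ratfun_eval.
  by apply/funext => i; case: ifP.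
split; last by rewrite /schur_normalized evP ?oner_eq0 // ev1 expr1n divr1 divff.
rewrite /schur_normalized evP // ev1.
have reorder (a b d q : F) : a / b / d * q = a * q / (d * b) by rewrite invfM; ring.
rewrite reorder (horner_order_at1 _ _ _ _ _ _ ik Pc).
rewrite [_ * P.[1]]mulrC -(mulrA P.[1]) -mulf_div divff // mul1r -!mulrA; congr (_ * _).
rewrite mulr_suml; apply: eq_bigr => j _; rewrite mulrAC; congr (_ / _).
  apply: (mulIf (expf_neq0 m x0)); rewrite divfK ?expf_neq0 //.
  by rewrite !exprnP -expfzDr // -lE gez0_abs.
by apply: eq_bigr => i _; rewrite !kE !lE !intrD opprD addrACA subrr addr0.
Qed.

(** * The complex exponential *)

Local Notation normc := ComplexField.Normc.normc.
Local Notation normc0 := ComplexField.Normc.normc0.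
Local Notation normc1 := ComplexField.Normc.normc1.
Local Notation normcM := ComplexField.Normc.normcM.
Local Notation normcV := ComplexField.Normc.normcV.

Section Modulus.
Variable R : rcfType.
Implicit Types z w : R[i].

Lemma mulcE (a b c d : R) :
  (a +i* b) * (c +i* d) = (a * c - b * d) +i* (a * d + b * c).
Proof. by []. Qed.

Lemma mul_realc (a c d : R) : a%:C * (c +i* d) = (a * c) +i* (a * d).
Proof. by rewrite mulcE !mul0r subr0 addr0. Qed.

Lemma normc_ge0 z : 0 <= normc z.
Proof. by case: z => a b; exact: sqrtr_ge0. Qed.

Lemma normc_add z w : normc (z + w) <= normc z + normc w.
Proof. exact: le_normcD. Qed.

Lemma normc_opp z : normc (- z) = normc z.
Proof. exact: normcN. Qed.

Lemma normc_sub z w : normc (z - w) <= normc z + normc w.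
Proof. by rewrite -[normc w]normc_opp normc_add. Qed.

Lemma normc_subC z w : normc (z - w) = normc (w - z).
Proof. by rewrite -normc_opp opprB. Qed.

Lemma normcX z n : normc (z ^+ n) = normc z ^+ n.
Proof. by elim: n => [|n IH]; rewrite ?expr0 ?normc1 // !exprS normcM IH. Qed.

Lemma normc_real (a : R) : normc a%:C = `|a|.
Proof. by rewrite /= expr0n addr0 sqrtr_sqr. Qed.

Lemma normc_nat n : normc (n%:R : R[i]) = n%:R.
Proof. by rewrite -(rmorph_nat (real_complex R)) normc_real normr_nat. Qed.

Lemma normc_sum (I : Type) (s : seq I) (P : pred I) (F : I -> R[i]) :
  normc (\sum_(i <- s | P i) F i) <= \sum_(i <- s | P i) normc (F i).
Proof.
elim/big_rec2: _ => [|i y x _ h]; first by rewrite normc0.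
by rewrite (le_trans (normc_add _ _)) // lerD2l.
Qed.

Lemma ler_normc_Re z : `|complex.Re z| <= normc z.
Proof.
by case: z => a b; rewrite /= -sqrtr_sqr ler_wsqrtr // lerDl sqr_ge0.
Qed.

Lemma ler_normc_Im z : `|complex.Im z| <= normc z.
Proof.
by case: z => a b; rewrite /= -sqrtr_sqr ler_wsqrtr // lerDr sqr_ge0.
Qed.

Lemma normc_le_ReIm z : normc z <= `|complex.Re z| + `|complex.Im z|.
Proof.
case: z => a b /=; have h : 0 <= `|a| + `|b| by rewrite addr_ge0.
apply: (@le_trans _ _ (Num.sqrt ((`|a| + `|b|) ^+ 2))); last first.
  by rewrite sqrtr_sqr ger0_norm.
rewrite ler_wsqrtr // sqrrD.
by rewrite !real_normK ?num_real // lerD2r lerDl mulrn_wge0 // mulr_ge0.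
Qed.

End Modulus.

(** * Truncated exponential series and the power series of [cexp] *)

Definition expsum (F : fieldType) (n : nat) (z : F) : F :=
  \sum_(k < n) z ^+ k / k`!%:R.

(** The truncation of [exp(z X)] in an auxiliary variable. Below degree [n] a product of two of them
    has the coefficients of [exp((z + w) X)], so the defect of multiplicativity of [expsum] is a sum
    of top coefficients. *)
Definition exppoly (F : fieldType) (n : nat) (z : F) : {poly F} :=
  \poly_(k < n) (z ^+ k / k`!%:R).

Lemma expsumE (F : fieldType) (n : nat) (z : F) : expsum F n z = (exppoly F n z).[1].
Proof.
rewrite /expsum /exppoly (horner_coef_wide _ (size_poly _ _)).
by apply: eq_bigr => i _; rewrite coef_poly ltn_ord expr1n mulr1.
Qed.

Lemma exppoly_coefM (F : numFieldType) (n m : nat) (z w : F) : (m < n)%N ->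
  (exppoly F n z * exppoly F n w)`_m = (z + w) ^+ m / m`!%:R.
Proof.
move=> mn; rewrite coefM addrC exprDn mulr_suml; apply: eq_bigr => j _.
rewrite !coef_poly (leq_ltn_trans (leq_ord j) mn).
rewrite (leq_ltn_trans (leq_subr j m) mn).
have -> : w ^+ (m - j) * z ^+ j *+ 'C(m, j) / m`!%:R =
    w ^+ (m - j) * z ^+ j * ('C(m, j)%:R / m`!%:R) by rewrite -mulr_natr mulrA.
rewrite -(bin_fact (leq_ord j)) !natrM !invfM (mulrA 'C(m, j)%:R) divff ?mul1r.
  by rewrite [_ * z ^+ j]mulrC mulrACA.
by rewrite pnatr_eq0 -lt0n bin_gt0 leq_ord.
Qed.

Lemma expsum_mul (F : numFieldType) (n : nat) (z w : F) :
  expsum F n z * expsum F n w - expsum F n (z + w) =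
  \sum_(m < n) (exppoly F n z * exppoly F n w)`_(n + m).
Proof.
rewrite !expsumE -hornerM.
have sz : (size (exppoly F n z * exppoly F n w)%R <= n + n)%N.
  rewrite (leq_trans (size_polyMleq _ _)) // (leq_trans (leq_pred _)) //.
  by rewrite leq_add ?size_poly.
rewrite (horner_coef_wide _ sz) big_split_ord /= -expsumE.
rewrite (eq_bigr (fun i : 'I_n => (z + w) ^+ i / i`!%:R)) => [|i _].
  rewrite -/(expsum F n (z + w)) addrAC subrr add0r.
  by apply: eq_bigr => i _; rewrite expr1n mulr1.
by rewrite exppoly_coefM // expr1n mulr1.
Qed.

Section ComplexExponential.
Variable R : realType.
Implicit Types (z w : R[i]) (x y : R).

(** The defect is a polynomial in [z] and [w] with nonnegative coefficients, hence dominated by its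
    value at the moduli, where real analysis applies. *)
Lemma expsum_add_error (n : nat) z w :
  normc (expsum R[i] n z * expsum R[i] n w - expsum R[i] n (z + w)) <=
  expsum R n (normc z) * expsum R n (normc w) - expsum R n (normc z + normc w).
Proof.
rewrite !expsum_mul; apply: le_trans (normc_sum _ _ _ _ _) _.
apply: ler_sum => m _; rewrite !coefM; apply: le_trans (normc_sum _ _ _ _ _) _.
have cE k v : normc ((exppoly R[i] n v)`_k) = (exppoly R n (normc v))`_k.
  rewrite !coef_poly; case: ifP => _; last exact: normc0.
  by rewrite normcM normcX normcV normc_nat.
by apply: ler_sum => k _; rewrite normcM !cE.
Qed.

Lemma cvg_expsum x : expsum R n x @[n --> \oo] --> expR x.
Proof.
have -> : (fun n => expsum R n x) = series (exp_coeff x).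
  by apply/funext => n; rewrite /series /= big_mkord.
exact: is_cvg_series_exp_coeff.
Qed.

Lemma expsum_real (n : nat) x : expsum R[i] n x%:C = (expsum R n x)%:C.
Proof.
rewrite rmorph_sum; apply: eq_bigr => k _.
by rewrite rmorphM fmorphV rmorph_nat rmorphXn.
Qed.

Lemma expsum_imag (n : nat) y :
  expsum R[i] n (0 +i* y) = series (cos_coeff y) n +i* series (sin_coeff y) n.
Proof.
rewrite /expsum /series /= !big_mkord; elim: n => [|n IH].
  by rewrite !big_ord0.
rewrite !big_ord_recr /= IH -[RHS]/((_ +i* _) + (_ +i* _)); congr (_ + _).
have -> : 0 +i* y = y%:C * 'i by rewrite mul_realc mulr0 mulr1.
rewrite exprMn -(rmorph_nat (real_complex R)) -fmorphV -rmorphXn.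
have -> : ('i : R[i]) ^+ n =
    ((~~ odd n)%:R * (-1) ^+ n./2) +i* ((odd n)%:R * (-1) ^+ n.-1./2).
  rewrite -[in LHS](odd_double_half n) exprD -mul2n exprM sqr_i.
  rewrite -(rmorphN1 (real_complex R)) -rmorphXn /= mulrC.
  case o: (odd n) => /=; last by rewrite expr0 mulr1 !mul0r !mul1r.
  rewrite expr1 mul_realc mulr0 mulr1 mul0r mul1r.
  by case: n o {IH} => // m /= om; rewrite uphalf_half (negbTE om).
rewrite mul_realc mulrC mul_realc /cos_coeff /sin_coeff /=.
by congr (_ +i* _); rewrite -?exprnP mulrC; congr (_ / _); exact: mulrC.
Qed.

Lemma cvg_normc_sub (u : nat -> R[i]) z :
  complex.Re (u n) @[n --> \oo] --> complex.Re z ->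
  complex.Im (u n) @[n --> \oo] --> complex.Im z ->
  normc (u n - z) @[n --> \oo] --> (0 : R).
Proof.
move=> uRe uIm.
have dist0 (v : nat -> R) (l : R) : v n @[n --> \oo] --> l ->
    `|v n - l| @[n --> \oo] --> (0 : R).
  move=> h; have -> : 0 = `|l - l| :> R by rewrite subrr normr0.
  by apply: cvg_norm; apply: cvgB => //; exact: cvg_cst.
have h : `|complex.Re (u n) - complex.Re z| + `|complex.Im (u n) - complex.Im z|
    @[n --> \oo] --> (0 + 0 : R).
  by apply: cvgD; exact: dist0.
rewrite addr0 in h; apply: (squeeze_cvgr _ (cvg_cst 0) h).
apply: nearW => n; rewrite normc_ge0 /=.
apply: le_trans (normc_le_ReIm _ _) _; rewrite le_eqVlt; apply/orP; left.
by case: (u n) (z) => [a b] [c d].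
Qed.

(** [cexp] is defined by real functions, while the divided difference is expanded through power
    series; this links the two. With [z = a + i b], [A] bounds the defect of multiplicativity
    between [a] and [i b], and [B] is the error of the product of the real exponential series with
    the cosine and sine series. *)
Lemma cvg_expsum_cexp z : normc (expsum R[i] n z - cexp z) @[n --> \oo] --> (0 : R).
Proof.
case: z => a b; set z := a +i* b.
have zE : z = a%:C + (0 +i* b) by rewrite /z -[RHS]/(_ +i* _) addr0 add0r.
pose A n := expsum R n `|a| * expsum R n `|b| - expsum R n (`|a| + `|b|).
have A0 : A n @[n --> \oo] --> (0 : R).
  rewrite -(subrr (expR (`|a| + `|b|))) {1}expRD.
  by apply: cvgB; [apply: cvgM|]; exact: cvg_expsum.
pose B n := normc (expsum R[i] n a%:C * expsum R[i] n (0 +i* b) - cexp z).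
have B0 : B n @[n --> \oo] --> (0 : R).
  have ccvg : series (cos_coeff b) n @[n --> \oo] --> cos b.
    by rewrite unlock; exact: is_cvg_series_cos_coeff.
  have scvg : series (sin_coeff b) n @[n --> \oo] --> sin b.
    by rewrite unlock; exact: is_cvg_series_sin_coeff.
  apply: cvg_normc_sub.
    under eq_fun do rewrite expsum_real expsum_imag mul_realc /=.
    rewrite /cexp mul_realc /=.
    by apply: cvgM => //; exact: cvg_expsum.
  under eq_fun do rewrite expsum_real expsum_imag mul_realc /=.
  rewrite /cexp mul_realc /=.
  by apply: cvgM => //; exact: cvg_expsum.
have AB : A n + B n @[n --> \oo] --> (0 : R).
  have -> : 0 = 0 + 0 :> R by rewrite addr0.
  exact: cvgD.
apply: (squeeze_cvgr _ (cvg_cst 0) AB); apply: nearW => n; rewrite normc_ge0 /=.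
have := expsum_add_error n a%:C (0 +i* b).
rewrite normc_real -zE [normc (0 +i* b)]/= expr0n add0r sqrtr_sqr -/(A n) => h.
apply: le_trans (lerD h (lexx (B n))); rewrite [X in _ <= X]addrC /B.
set P := _ * _; set S := expsum _ _ _.
have -> : S - cexp z = (P - cexp z) - (P - S) by ring.
exact: normc_sub.
Qed.

Lemma cexpD z w : cexp (z + w) = cexp z * cexp w.
Proof.
case: z w => [a b] [c d]; rewrite /cexp /= expRD cosD sinD !mul_realc mulcE.
by congr (_ +i* _); ring.
Qed.

Lemma cexp0 : cexp 0 = 1 :> R[i].
Proof. by rewrite /cexp /= expR0 cos0 sin0 mul1r. Qed.

Lemma cexpN z : cexp (- z) * cexp z = 1.
Proof. by rewrite -cexpD addNr cexp0. Qed.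

Lemma cexp_neq0 z : cexp z != 0.
Proof.
by apply/eqP => e; have /eqP := cexpN z; rewrite e mulr0 eq_sym oner_eq0.
Qed.

Lemma cexpNV z : cexp (- z) = (cexp z)^-1.
Proof. by apply: (mulIf (cexp_neq0 z)); rewrite cexpN mulVf ?cexp_neq0. Qed.

Lemma normc_cexp z : normc (cexp z) = expR (complex.Re z).
Proof.
rewrite /cexp normcM normc_real ger0_norm ?expR_ge0 //=.
by rewrite cos2Dsin2 sqrtr1 mulr1.
Qed.

Lemma cexpXz z (m : int) : cexp z ^ m = cexp (z * m%:~R).
Proof.
have XN (n : nat) : cexp z ^+ n = cexp (z * n%:R).
  elim: n => [|n IH]; first by rewrite mulr0 cexp0.
  by rewrite exprS IH -cexpD -{1}[z]mulr1 -mulrDr nat1r.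
case: m => n; first by rewrite -exprnP XN.
by rewrite NegzE -exprnN XN mulrNz mulrN cexpNV.
Qed.

End ComplexExponential.

(** * Gaussian limit of the centered divided difference *)

(* A sequence whose [k]-th term is controlled by [A / k] times the maximum of
   the earlier ones stops growing as soon as [k >= A]. *)
Lemma recursive_bound (R : realType) (A : R) : 0 <= A ->
  exists2 C : R, 0 <= C & forall (e : R) (b : nat -> R), 0 <= e -> b 0%N <= e ->
    (forall k X, e <= X -> (forall i, (i <= k)%N -> b i <= X) ->
      k.+1%:R * b k.+1 <= A * X) ->
    forall k, b k <= C * e.
Proof.
move=> A0; pose K := Num.bound A; have AK : A < K%:R by exact: archi_boundP.
have A1 : 1 <= 1 + A by rewrite lerDl.
(* Each of the first [K] steps costs at most a factor [1 + A]; the later ones cost nothing, since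
   [A < K]. *)
exists ((1 + A) ^+ K); first by rewrite exprn_ge0 // addr_ge0.
move=> e b e0 b0 hb.
have bk k i : (i <= k)%N -> b i <= (1 + A) ^+ minn k K * e.
  elim: k i => [|k IH] i; first by rewrite leqn0 => /eqP ->; rewrite min0n mul1r.
  set X := (1 + A) ^+ minn k K * e in IH.
  have X0 : 0 <= X by rewrite mulr_ge0 // exprn_ge0 // addr_ge0.
  have eX : e <= X by rewrite ler_peMl // exprn_ege1.
  have XX : X <= (1 + A) ^+ minn k.+1 K * e.
    by rewrite ler_wpM2r // ler_weXn2l // leq_min geq_minr andbT leqW // geq_minl.
  rewrite leq_eqVlt => /orP[/eqP ->|]; last by rewrite ltnS => /IH h; apply: le_trans XX.
  have := hb k X eX IH; have [kK|Kk] := ltnP k K.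
    rewrite (minn_idPl kK) exprS -mulrA -[k in (1 + A) ^+ k](minn_idPl (ltnW kK)) -/X.
    (* [b] may take negative values, for which [b k.+1 <= k.+1 * b k.+1] fails but the bound is
       trivial. *)
    move=> h; have [bn|bp] := ltP (b k.+1) 0.
      by rewrite (le_trans (ltW bn)) // mulr_ge0 // addr_ge0.
    apply: (@le_trans _ _ (A * X)); last by rewrite ler_wpM2r // lerDr.
    by apply: le_trans h; rewrite ler_peMl // ler1n.
  move=> h; apply: le_trans XX.
  have k0 : 0 < k.+1%:R :> R by rewrite ltr0n.
  rewrite -(ler_pM2l k0); apply: le_trans h _; rewrite ler_wpM2r //.
  by apply: le_trans (ltW AK) _; rewrite ler_nat leqW.
move=> k; apply: le_trans (bk k k (leqnn _)) _.
by rewrite ler_wpM2r // ler_weXn2l // geq_minr.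
Qed.

(* The coefficient of [t^k] in [exp (p t^2 / 2)]. *)
Definition gausscoef (F : fieldType) (p : F) (k : nat) : F :=
  if odd k then 0 else (p / 2) ^+ k./2 / k./2`!%:R.

(** Newton's recursion with [p_2] as the only nonzero power sum, or the equation [G' = p t G] for
    the generating series. *)
Lemma gausscoefSS (F : numFieldType) (p : F) (k : nat) :
  k.+2%:R * gausscoef F p k.+2 = p * gausscoef F p k.
Proof.
rewrite /gausscoef /= negbK; case: ifP => ok; first by rewrite !mulr0.
have e : k.+2%:R = 2 * (k./2.+1)%:R :> F.
  by rewrite -natrM -[in LHS](odd_double_half k) ok add0n mul2n doubleS.
rewrite e factS natrM exprS.
have h1 : (k./2.+1)%:R != 0 :> F by rewrite pnatr_eq0.
have h2 : k./2`!%:R != 0 :> F by rewrite pnatr_eq0 -lt0n fact_gt0.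
by field; rewrite h2 nat1r h1.
Qed.

Lemma sum_gausscoef (F : fieldType) (p : F) (m : nat) :
  \sum_(k < m.*2) gausscoef F p k = expsum F m (p / 2).
Proof.
rewrite /expsum; elim: m => [|m IH]; first by rewrite !big_ord0.
rewrite doubleS !big_ord_recr /= IH /gausscoef /= odd_double /= addr0.
by rewrite doubleK.
Qed.

Lemma sum_geo_half (R : numFieldType) (K : nat) : \sum_(k < K) (1 / 2) ^+ k <= 2 :> R.
Proof.
suff e : \sum_(k < K) (1 / 2) ^+ k = 2 - 2 * (1 / 2) ^+ K :> R.
  by rewrite e gerBl mulr_ge0 // exprn_ge0 // divr_ge0.
elim: K => [|K IH]; first by rewrite big_ord0 expr0; ring.
by rewrite big_ord_recr /= IH exprS; field.
Qed.

Lemma sum_sqr_half (R : numFieldType) (K : nat) :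
  \sum_(k < K) k%:R ^+ 2 * (1 / 2) ^+ k <= 6 :> R.
Proof.
suff e : \sum_(k < K) k%:R ^+ 2 * (1 / 2) ^+ k =
    6 - 2 * (K%:R ^+ 2 + 2 * K%:R + 3) * (1 / 2) ^+ K :> R.
  rewrite e gerBl mulr_ge0 // ?exprn_ge0 ?divr_ge0 // mulr_ge0 //.
elim: K => [|K IH]; first by rewrite big_ord0 expr0 expr0n /=; ring.
by rewrite big_ord_recr /= IH (exprS _ K) -(natr1 K); field.
Qed.

Section MainEstimate.
Variable R : realType.

(* By Newton's identity, [h_k] differs from the Gaussian coefficient by terms
   containing some [p_m] with [m >= 3], each of size [O(q)]. *)
Lemma symh_bound (B : R) : 0 <= B ->
  exists2 C : R, 0 <= C & forall (s : seq R[i]) (q : R), 0 <= q <= 1 / 4 ->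
    powsum R[i] s 1 = 0 ->
    (forall m, normc (powsum R[i] s m.+2) <= B * q ^+ m) ->
    forall k, normc (symh R[i] s k) * 2 ^+ k <= C /\
      normc (symh R[i] s k - gausscoef R[i] (powsum R[i] s 2) k) * 2 ^+ k <= C * q.
Proof.
(* With the weights [2^k], the term of [p_(m+2)] in Newton's identity costs
   [4 B (2 q)^m <= 4 B / 2^m], because [q <= 1/4]; the geometric series gives [8 B]. For the
   difference from the Gaussian coefficients, [p_2] alone costs [4 B], and the added 1 pays for the
   source term. *)
move=> B0; have [C0 C00 hC0] := recursive_bound R (8 * B) (mulr_ge0 (ler0n _ _) B0).
have [C1 C10 hC1] := recursive_bound R (4 * B + 1) (addr_ge0 (mulr_ge0 (ler0n _ _) B0) ler01).
exists (C0 + C1 * (16 * B * C0)).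
  by rewrite addr_ge0 // !mulr_ge0.
move=> s q /andP[q0 q4] p1 pm.
pose h := symh R[i] s; pose p := powsum R[i] s.
have {}pm m : normc (p m.+2) <= B * q ^+ m by exact: pm.
have newt k : k.+1%:R * h k.+1 = \sum_(m < k) p m.+2 * h (k - m.+1)%N.
  rewrite /h symh_newton big_ord_recl p1 mul0r add0r.
  by apply: eq_bigr => m _; rewrite lift0 subSS.
have scale k m : (m < k)%N -> 2 ^+ k.+1 = 2 ^+ m.+2 * 2 ^+ (k - m.+1) :> R.
  by move=> mk; rewrite -exprD addSn subnKC.
have term k m X : (m < k)%N -> normc (h (k - m.+1)%N) * 2 ^+ (k - m.+1) <= X ->
    normc (p m.+2 * h (k - m.+1)%N) * 2 ^+ k.+1 <= 4 * B * X * (2 * q) ^+ m.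
  move=> mk hX; rewrite normcM (scale k m mk) mulrACA.
  have -> : 4 * B * X * (2 * q) ^+ m = (B * q ^+ m * 2 ^+ m.+2) * X.
    by rewrite exprMn !exprS; ring.
  have t0 (i : nat) : 0 <= 2 ^+ i :> R by rewrite exprn_ge0.
  apply: ler_pM hX; [exact: mulr_ge0 (normc_ge0 _ _) (t0 _)
    |exact: mulr_ge0 (normc_ge0 _ _) (t0 _)|exact: ler_wpM2r (t0 _) _ _ (pm m)].
have q2 m : (2 * q) ^+ m <= (1 / 2) ^+ m.
  rewrite lerXn2r ?nnegrE ?mulr_ge0 //; lra.
have hb k : normc (h k) * 2 ^+ k <= C0.
  rewrite -[C0]mulr1; apply: (hC0 1 (fun k => normc (h k) * 2 ^+ k)) => //.
    by rewrite /h symh0 normc1 mul1r.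
  move=> {}k X X1 hX; have X0 : 0 <= X by rewrite (le_trans _ X1).
  rewrite mulrA -(normc_nat R k.+1) -normcM newt.
  apply: (@le_trans _ _ (\sum_(m < k) normc (p m.+2 * h (k - m.+1)%N) * 2 ^+ k.+1)).
    by rewrite -mulr_suml ler_wpM2r ?exprn_ge0 // normc_sum.
  apply: (@le_trans _ _ (\sum_(m < k) 4 * B * X * (1 / 2) ^+ m)).
    apply: ler_sum => m _; apply: le_trans (term _ _ _ (ltn_ord m) (hX _ (leq_subr _ _))) _.
    by rewrite ler_wpM2l ?mulr_ge0.
  rewrite -mulr_sumr; apply: le_trans (ler_wpM2l _ (sum_geo_half _ k)) _.
    by rewrite !mulr_ge0.
  by rewrite le_eqVlt; apply/orP; left; apply/eqP; ring.
move=> k; split.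
  by apply: le_trans (hb k) _; rewrite lerDl !mulr_ge0.
pose d k := h k - gausscoef R[i] (p 2) k; rewrite -/(d k).
have d0 : d 0%N = 0 by rewrite /d /h symh0 /gausscoef /= expr0 divr1 subrr.
have h1 : h 1%N = 0 by have := newt 0%N; rewrite big_ord0 mul1r.
have d1 : d 1%N = 0 by rewrite /d h1 /gausscoef /= subr0.
have dS j : j.+2%:R * d j.+2 = p 2 * d j + \sum_(m < j) p m.+3 * h (j - m.+1)%N.
  rewrite /d mulrBr newt gausscoefSS big_ord_recl subSS subn0.
  under eq_bigr do rewrite lift0 subSS.
  by rewrite mulrBr addrAC.
(* The source term of [dS]: its summands are at most [8 B C0 q (2 q)^m], with one factor [q] to
   spare since they start at [p_3]. *)
pose e := 16 * B * C0 * q; have e0 : 0 <= e by rewrite !mulr_ge0.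
apply: (@le_trans _ _ (C1 * e)); last first.
  have -> : (C0 + C1 * (16 * B * C0)) * q = C0 * q + C1 * e by rewrite /e; ring.
  by rewrite lerDr mulr_ge0.
apply: (hC1 e (fun k => normc (d k) * 2 ^+ k)) => // [|{}k X eX hX].
  by rewrite d0 normc0 mul0r.
have X0 : 0 <= X by apply: le_trans eX.
case: k hX => [|k] hX; first by rewrite d1 normc0 mul0r mulr0 mulr_ge0 // addr_ge0 // mulr_ge0.
rewrite mulrA -(normc_nat R k.+2) -normcM dS.
apply: (@le_trans _ _ ((normc (p 2 * d k) +
    \sum_(m < k) normc (p m.+3 * h (k - m.+1)%N)) * 2 ^+ k.+2)).
  rewrite ler_wpM2r ?exprn_ge0 //; apply: le_trans (normc_add _ _ _) _.
  by rewrite lerD2l normc_sum.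
rewrite mulrDl [X in _ <= X]mulrDl mul1r; apply: lerD.
  have -> : normc (p 2 * d k) * 2 ^+ k.+2 = normc (p 2) * 4 * (normc (d k) * 2 ^+ k).
    by rewrite normcM !exprS; ring.
  rewrite (mulrC 4); apply: ler_pM; rewrite ?mulr_ge0 ?normc_ge0 ?exprn_ge0 //.
    by have := pm 0%N; rewrite expr0 mulr1 => ?; rewrite ler_wpM2r.
  by apply: hX; exact: leqnSn.
apply: le_trans eX; rewrite mulr_suml.
apply: (@le_trans _ _ (\sum_(m < k) 8 * B * C0 * q * (1 / 2) ^+ m)); last first.
  rewrite -mulr_sumr; apply: le_trans (ler_wpM2l _ (sum_geo_half _ k)) _.
    by rewrite !mulr_ge0.
  by rewrite /e le_eqVlt; apply/orP; left; apply/eqP; ring.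
apply: ler_sum => m _.
have -> : 2 ^+ k.+2 = 2 ^+ m.+3 * 2 ^+ (k - m.+1) :> R.
  by rewrite exprS (scale k m (ltn_ord m)) mulrA -exprS.
rewrite normcM mulrACA.
apply: (@le_trans _ _ ((B * q ^+ m.+1) * 2 ^+ m.+3 * C0)).
  have t0 (i : nat) : 0 <= 2 ^+ i :> R by rewrite exprn_ge0.
  apply: ler_pM (hb _); [exact: mulr_ge0 (normc_ge0 _ _) (t0 _)
    |exact: mulr_ge0 (normc_ge0 _ _) (t0 _)|exact: ler_wpM2r (t0 _) _ _ (pm _)].
have -> : B * q ^+ m.+1 * 2 ^+ m.+3 * C0 = 8 * B * C0 * q * (2 * q) ^+ m.
  by rewrite exprMn !exprS; ring.
by rewrite ler_wpM2l // !mulr_ge0.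
Qed.

Definition fact_ratio (n k : nat) : R := n`!%:R * n.+1%:R ^+ k / (n + k)`!%:R.

Lemma fact_ratioS n k :
  fact_ratio n k.+1 = fact_ratio n k * (n.+1%:R / (n.+1 + k)%:R).
Proof.
rewrite /fact_ratio addnS factS natrM exprS.
have h1 : (n + k).+1%:R != 0 :> R by rewrite pnatr_eq0.
have h2 : (n + k)`!%:R != 0 :> R by rewrite pnatr_eq0 -lt0n fact_gt0.
by rewrite invfM addSn; ring.
Qed.

(** The ratio is a product of factors [(n+1) / (n+1+i)] for [i < k], each within [i / (n+1)] of 1. A
    loss quadratic in [k] is harmless against the decay [2^-k] of [symh]. *)
Lemma fact_ratio_bounds n k :
  0 <= fact_ratio n k <= 1 /\ 1 - fact_ratio n k <= k%:R ^+ 2 / n.+1%:R.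
Proof.
have n0 : 0 < n.+1%:R :> R by rewrite ltr0n.
elim: k => [|k [/andP[r0 r1] hr]].
  rewrite /fact_ratio addn0 expr0 mulr1 divff ?pnatr_eq0 -?lt0n ?fact_gt0 //.
  by rewrite ler01 lexx subrr expr0n mul0r.
have nk0 : 0 < (n.+1 + k)%:R :> R by rewrite ltr0n.
have c0 : 0 <= n.+1%:R / (n.+1 + k)%:R :> R by rewrite divr_ge0.
have c1 : n.+1%:R / (n.+1 + k)%:R <= 1 :> R by rewrite ler_pdivrMr // mul1r ler_nat leq_addr.
have c2 : 1 - n.+1%:R / (n.+1 + k)%:R <= k%:R / n.+1%:R :> R.
  rewrite -{1}(divff (lt0r_neq0 nk0)) -mulrBl natrD addrAC subrr add0r.
  by rewrite -natrD ler_wpM2l // lef_pV2 ?posrE // ler_nat leq_addr.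
rewrite fact_ratioS; split; first by rewrite mulr_ge0 // mulr_ile1.
set c := _ / _ in c0 c1 c2 *.
have -> : 1 - fact_ratio n k * c = (1 - fact_ratio n k) + fact_ratio n k * (1 - c) by ring.
apply: (@le_trans _ _ (k%:R ^+ 2 / n.+1%:R + k%:R / n.+1%:R)).
  by apply: lerD => //; apply: le_trans c2; rewrite ler_piMl // subr_ge0.
rewrite -mulrDl ler_wpM2r ?invr_ge0 // -(natr1 k) -subr_ge0.
have : 0 <= k%:R :> R by [].
set x := k%:R; move=> x0; have -> : (x + 1) ^+ 2 - (x ^+ 2 + x) = x + 1 by ring.
by rewrite addr_ge0.
Qed.

(** [s] holds the [z_j], scaled so that their second power sum stays bounded. The actual nodes are
    [N z_j], whence the power [N^k] in [fact_ratio]. *)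
Definition centered_sum (s : seq R[i]) : R[i] :=
  (size s).-1`!%:R * divdiff R[i] [seq (size s)%:R * x | x <- s] (@cexp R).

(** Powers below [N - 1] have divided difference 0, and the power [N - 1 + k] gives [h_k];
    truncating at [N - 1 + K] leaves exactly [K] terms. *)
Lemma divdiff_expsum (s : seq R[i]) (K : nat) : uniq s -> (0 < size s)%N ->
  (size s).-1`!%:R * divdiff R[i] [seq (size s)%:R * x | x <- s]
    (expsum R[i] ((size s).-1 + K)) =
  \sum_(k < K) (fact_ratio (size s).-1 k)%:C * symh R[i] s k.
Proof.
move=> us s0; set N := size s; set n := N.-1.
have nN : n.+1 = N by rewrite /n prednK.
have N0 : N%:R != 0 :> R[i] by rewrite pnatr_eq0 -lt0n.
set t := [seq _ | x <- s].
have ut : uniq t by rewrite map_inj_uniq //; exact: mulfI.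
have st : size t = N by rewrite size_map.
have dE k : divdiff R[i] t (fun x => x ^+ k / k`!%:R) =
    divdiff R[i] t (fun x => x ^+ k) / k`!%:R.
  rewrite mulrC -divdiffZ; apply: eq_divdiff => x; exact: mulrC.
have -> := divdiff_sum _ t (n + K) (fun i x => x ^+ i / i`!%:R).
rewrite big_split_ord /= big1 ?add0r => [|i _]; last first.
  by rewrite dE divdiff_exp_small ?mul0r // st -nN ltnS.
rewrite mulr_sumr; apply: eq_bigr => k _; rewrite dE addnC.
have -> : divdiff R[i] t (fun x => x ^+ (k + n)) = symh R[i] t k.
  by rewrite -(divdiff_exp _ _ _ ut) st.
rewrite symh_scale /fact_ratio nN !rmorphM fmorphV rmorphXn !rmorph_nat.
by rewrite addnC; ring.
Qed.

(** Pointwise convergence is enough: the nodes and weights stay fixed while the truncation order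
    grows, so [m0] may depend on them. *)
Lemma expsum_cexp_eps (t : seq R[i]) (a : R[i] -> R[i]) (e : R) : 0 < e ->
  exists m0, forall m, (m0 <= m)%N ->
    normc (\sum_(x <- t) a x * (expsum R[i] m x - cexp x)) <= e.
Proof.
elim: t e => [|x t IH] e e0; first by exists 0%N => m _; rewrite big_nil normc0 ltW.
have e2 : 0 < e / 2 by rewrite divr_gt0.
have [m0 h0] := IH _ e2.
pose c := normc (a x) + 1; have c0 : 0 < c by rewrite ltr_wpDl ?normc_ge0.
have /cvgrPdist_le /(_ _ (divr_gt0 e2 c0)) [m1 _ h1] := cvg_expsum_cexp R x.
exists (maxn m0 m1) => m; rewrite geq_max => /andP[hm0 hm1].
rewrite big_cons; apply: le_trans (normc_add _ _ _) _.
rewrite [leRHS](splitr e); apply: lerD (h0 _ hm0); rewrite normcM.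
have := h1 m hm1; rewrite /= sub0r normrN ger0_norm ?normc_ge0 // => h.
apply: (@le_trans _ _ (c * (e / 2 / c))); last by rewrite mulrC divfK ?lt0r_neq0.
by apply: ler_pM; rewrite ?normc_ge0 // lerDl.
Qed.

Lemma centered_sum_estimate (B : R) : 0 <= B ->
  exists2 C : R, 0 <= C & forall (s : seq R[i]) (q : R), 0 <= q <= 1 / 4 ->
    uniq s -> (0 < size s)%N -> powsum R[i] s 1 = 0 ->
    (forall m, normc (powsum R[i] s m.+2) <= B * q ^+ m) ->
    normc (centered_sum s - cexp (powsum R[i] s 2 / 2)) <= C * (q + (size s)%:R^-1).
Proof.
move=> B0; have [C C0 hC] := symh_bound B B0.
(* 6 is the sum of [k^2 / 2^k], met with the error of [fact_ratio]; it also covers the 2 of the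
   geometric series. *)
exists (6 * C); first by rewrite mulr_ge0.
move=> s q q4 us s0 p1 pm; have hk := hC s q q4 p1 pm.
have q0 : 0 <= q by case/andP: q4.
set p := powsum R[i] s 2 in hk *; set n := (size s).-1.
have nN : n.+1 = size s by rewrite /n prednK.
have half k x y : x * 2 ^+ k <= y -> x <= y * (1 / 2) ^+ k :> R.
  by rewrite div1r exprVn ler_pdivlMr ?exprn_gt0.
have partial K : normc (\sum_(k < K) (fact_ratio n k)%:C * symh R[i] s k
    - \sum_(k < K) gausscoef R[i] p k) <= 6 * C * (q + n.+1%:R^-1).
  rewrite -sumrB; apply: le_trans (normc_sum _ _ _ _ _) _.
  apply: (@le_trans _ _ (\sum_(k < K) (C * q * (1 / 2) ^+ k +
      C / n.+1%:R * (k%:R ^+ 2 * (1 / 2) ^+ k)))).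
    apply: ler_sum => k _; have [hk1 hk2] := hk k.
    have [/andP[r0 r1] r2] := fact_ratio_bounds n k.
    set r := fact_ratio n k in r0 r1 r2 *.
    have -> : r%:C * symh R[i] s k - gausscoef R[i] p k =
      (symh R[i] s k - gausscoef R[i] p k) - (1 - r)%:C * symh R[i] s k.
      by rewrite rmorphB rmorph1; ring.
    apply: le_trans (normc_sub _ _ _) _; apply: lerD; first exact: half.
    rewrite normcM normc_real ger0_norm ?subr_ge0 //.
    have -> : C / n.+1%:R * (k%:R ^+ 2 * (1 / 2) ^+ k) =
      k%:R ^+ 2 / n.+1%:R * (C * (1 / 2) ^+ k) by ring.
    by apply: ler_pM; rewrite ?subr_ge0 ?normc_ge0 //; exact: half.
  rewrite big_split /= -!mulr_sumr.
  apply: (@le_trans _ _ (C * q * 2 + C / n.+1%:R * 6)).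
    by apply: lerD; apply: ler_wpM2l; rewrite ?mulr_ge0 ?sum_geo_half ?sum_sqr_half ?invr_ge0.
  have -> : 6 * C * (q + n.+1%:R^-1) = 6 * (C * q) + C / n.+1%:R * 6 by ring.
  by rewrite lerD2r [leLHS]mulrC ler_wpM2r ?mulr_ge0 // ler_nat.
(* The bound [partial] does not depend on [K], so the truncation order is now taken large at the
   price of [e]. With [K = m.*2] the Gaussian sum is the [m]-th partial sum of [exp(p / 2)]. *)
apply/ler_addgt0Pr => e e0; have e2 : 0 < e / 2 by rewrite divr_gt0.
pose t := [seq (size s)%:R * x | x <- s].
have [m0 h0] := expsum_cexp_eps t
  (fun x => n`!%:R / \prod_(y <- t | y != x) (x - y)) _ e2.
have [m1 h1] := expsum_cexp_eps [:: p / 2] (fun=> 1) _ e2.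
pose m := maxn m0 m1.
have {}h1 : normc (expsum R[i] m (p / 2) - cexp (p / 2)) <= e / 2.
  by have := h1 m (leq_maxr _ _); rewrite big_seq1 mul1r.
have {}h0 : normc (n`!%:R * divdiff R[i] t (expsum R[i] (n + m.*2)) - centered_sum s) <= e / 2.
  have mm : (m0 <= n + m.*2)%N.
    by rewrite (leq_trans (leq_maxl m0 m1)) // -/m -addnn addnA leq_addl.
  apply: le_trans (h0 _ mm); rewrite le_eqVlt; apply/orP; left; apply/eqP.
  rewrite /centered_sum -/n -/t -mulrBr -divdiffB /divdiff mulr_sumr.
  by congr normc; apply: eq_bigr => x _; ring.
have := partial m.*2; rewrite -divdiff_expsum // sum_gausscoef -/n -/t nN => hp.
set D := _ * divdiff _ _ _ in h0 hp.
have -> : centered_sum s - cexp (p / 2) = (D - expsum R[i] m (p / 2)) +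
  (expsum R[i] m (p / 2) - cexp (p / 2)) - (D - centered_sum s) by ring.
apply: le_trans (normc_sub _ _ _) _; rewrite [e]splitr [leRHS]addrA; apply: lerD => //.
by apply: le_trans (normc_add _ _ _) _; apply: lerD.
Qed.

End MainEstimate.

(** * Riemann sums of decreasing functions *)

Section RiemannSums.
Variable R : realType.
Local Notation mu := (@lebesgue_measure R).
Local Notation I01 := (`[0, 1]%classic : set R).
Implicit Types phi psi : R -> R.

(** Monotonicity is known on [[0, 1]] only; composition with the projection onto this interval makes
    it global. *)
Lemma wdecr_measurable phi :
  weakly_decreasing01 phi -> measurable_fun I01 phi.
Proof.
move=> d; pose clamp (x : R) := Num.min (Num.max x 0) 1.
apply: (@eq_measurable_fun _ _ _ _ _ (phi \o clamp)).
  move=> x; rewrite inE /= in_itv /= => /andP[x0 x1].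
  by rewrite /clamp (max_idPl x0) (min_idPl x1).
apply: nonincreasing_measurable => // x y xy; apply: d.
- by rewrite /clamp le_min ler01 andbT le_max lexx orbT.
- rewrite /clamp le_min ge_min [X in _ && X]ge_min lexx orbT andbT.
  by rewrite ge_max !le_max xy lexx orbT.
- by rewrite /clamp ge_min lexx orbT.
Qed.

Lemma bounded_integrable01 phi (K : R) : measurable_fun I01 phi ->
  (forall x, 0 <= x <= 1 -> `|phi x| <= K) ->
  mu.-integrable I01 (EFin \o phi).
Proof.
move=> m b; apply: measurable_bounded_integrable => //.
  by rewrite /= lebesgue_measure_itv /= lte_fin ltr01 -EFinB ltry.
exists K; split; first exact: num_real.
move=> M KM x /=; rewrite in_itv /= => x01.
by apply: le_trans (b _ x01) (ltW KM).
Qed.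

Lemma wdecr_bounded phi : weakly_decreasing01 phi ->
  forall x, 0 <= x <= 1 -> `|phi x| <= `|phi 0| + `|phi 1|.
Proof.
move=> d x /andP[x0 x1]; have h0 := d _ _ (lexx 0) x0 x1.
have h1 := d _ _ x0 x1 (lexx 1).
have := ler_norm (phi 0); have := ler_norm (- phi 1); rewrite normrN.
have := normr_ge0 (phi 0); have := normr_ge0 (phi 1).
by move=> *; rewrite ler_norml; apply/andP; split; lra.
Qed.

Lemma wdecr_integrable phi : weakly_decreasing01 phi ->
  mu.-integrable I01 (EFin \o phi).
Proof.
by move=> d; apply: bounded_integrable01 (wdecr_measurable _ d) (wdecr_bounded _ d).
Qed.

Lemma Rintegral_cst_itv (a b c : R) : a <= b ->
  \int[mu]_(x in `]a, b]) c = c * (b - a).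
Proof.
move=> ab; rewrite Rintegral_cst //= lebesgue_measure_itv /= lte_fin.
case: ltP => [_|ba]; first by rewrite -EFinB.
have -> : a = b by apply/le_anti; rewrite ab ba.
by rewrite subrr.
Qed.

Definition avg (N : nat) (a : nat -> R) : R := (\sum_(j < N) a j) / N%:R.

(** Right and left sums enclose the integral and differ by a telescoping sum. Monotonicity alone
    thus gives the rate [1 / N], which survives the later multiplication by [sqrt N]. *)
Lemma riemann_wdecr phi (N : nat) : (0 < N)%N -> weakly_decreasing01 phi ->
  `|avg N (fun j => phi (j.+1%:R / N%:R)) - \int[mu]_(x in `[0, 1]) phi x|
    <= (phi 0 - phi 1) / N%:R.
Proof.
move=> N0 d; have N0' : 0 < N%:R :> R by rewrite ltr0n.
have pt0 (k : nat) : 0 <= k%:R / N%:R :> R by rewrite divr_ge0.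
have pt1 k : (k <= N)%N -> k%:R / N%:R <= 1 :> R.
  by move=> kN; rewrite ler_pdivrMr // mul1r ler_nat.
have ptS (k : nat) : k%:R / N%:R <= k.+1%:R / N%:R :> R.
  by rewrite ler_wpM2r ?invr_ge0 // ler_nat.
have int := wdecr_integrable _ d.
have bounds k : (k <= N)%N ->
    \sum_(j < k) phi (j.+1%:R / N%:R) / N%:R <= \int[mu]_(x in `[0, k%:R / N%:R]) phi x
    <= \sum_(j < k) phi (j%:R / N%:R) / N%:R.
  elim: k => [|k IH] kN; first by rewrite !big_ord0 mul0r set_itv1 Rintegral_set1 lexx.
  have /andP[I1 I2] := IH (ltnW kN).
  have intk : mu.-integrable `[0, k.+1%:R / N%:R] (EFin \o phi).
    apply: integrableS int => // x /=; rewrite !in_itv /= => /andP[-> h].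
    exact: le_trans h (pt1 _ kN).
  have intS : mu.-integrable `]k%:R / N%:R, k.+1%:R / N%:R] (EFin \o phi).
    apply: integrableS intk => // x /=; rewrite !in_itv /= => /andP[h ->].
    by rewrite (le_trans (pt0 k) (ltW h)).
  have := @Rintegral_itvB R phi (BLeft 0) (BRight (k.+1%:R / N%:R)) (k%:R / N%:R) intk.
  rewrite !bnd_simp => /(_ (pt0 k) (ptS k)) /eqP; rewrite subr_eq => /eqP ->.
  have intc c : mu.-integrable `]k%:R / N%:R, k.+1%:R / N%:R] (EFin \o (fun=> c)).
    apply: integrableS (wdecr_integrable (fun=> c) _) => //.
    move=> x /=; rewrite !in_itv /= => /andP[h1 h2].
    by rewrite (le_trans (pt0 k) (ltW h1)) (le_trans h2 (pt1 _ kN)).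
  have w : k.+1%:R / N%:R - k%:R / N%:R = N%:R^-1 :> R.
    by rewrite -mulrBl -natr1 addrAC subrr add0r mul1r.
  have cstE c : \int[mu]_(x in `]k%:R / N%:R, k.+1%:R / N%:R]) c = c / N%:R.
    by rewrite Rintegral_cst_itv // w.
  rewrite !big_ord_recr /= [X in X <= _ <= _]addrC [X in _ <= _ <= X]addrC.
  apply/andP; split; apply: lerD => //.
    rewrite -(cstE (phi (k.+1%:R / N%:R))); apply: le_Rintegral => // x /=.
    rewrite in_itv /= => /andP[h1 h2]; apply: d => //; last exact: pt1.
    exact: le_trans (pt0 k) (ltW h1).
  rewrite -(cstE (phi (k%:R / N%:R))); apply: le_Rintegral => // x /=.
  rewrite in_itv /= => /andP[h1 h2]; apply: d => //; first exact: ltW.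
  exact: le_trans h2 (pt1 _ kN).
have := bounds N (leqnn N); rewrite divff ?lt0r_neq0 // => /andP[lo hi].
pose g (j : nat) := phi (j%:R / N%:R) / N%:R.
have tel m : \sum_(j < m) g j = \sum_(j < m) g j.+1 + (g 0%N - g m).
  elim: m => [|m IH]; first by rewrite !big_ord0 subrr addr0.
  by rewrite !big_ord_recr /= IH; ring.
have {}tel : \sum_(j < N) phi (j%:R / N%:R) / N%:R =
    \sum_(j < N) phi (j.+1%:R / N%:R) / N%:R + (phi 0 - phi 1) / N%:R.
  by rewrite [LHS]tel /g mul0r divff ?lt0r_neq0 // mulrBl.
rewrite tel -mulr_suml in lo hi; rewrite distrC ger0_norm ?subr_ge0 //.
by rewrite lerBlDl.
Qed.

(** [phi^2] need not be monotone, but [phi + K] is nonnegative and decreasing, hence so is its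
    square; [phi^2] is a linear combination of this square, [phi] and a constant. *)
Lemma riemann_sqr phi : weakly_decreasing01 phi ->
  exists D : R, forall N : nat, (0 < N)%N ->
  `|avg N (fun j => phi (j.+1%:R / N%:R) ^+ 2) - \int[mu]_(x in `[0, 1]) (phi x ^+ 2)|
    <= D / N%:R.
Proof.
move=> d; pose K := `|phi 0| + `|phi 1|.
have Kb x : 0 <= x <= 1 -> 0 <= phi x + K.
  by move=> /(wdecr_bounded _ d); rewrite ler_norml -/K => /andP[? _]; lra.
pose psi x := (phi x + K) ^+ 2.
have dpsi : weakly_decreasing01 psi.
  move=> x y x0 xy y1; have := d _ _ x0 xy y1 => h; rewrite /psi lerXn2r ?nnegrE ?lerD2r //.
    by rewrite Kb // (le_trans x0 xy) y1.
  by rewrite Kb // x0 (le_trans xy y1).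
have ip := wdecr_integrable _ d; have ips := wdecr_integrable _ dpsi.
have mI : measurable (I01 : set R) by [].
have ic c : mu.-integrable I01 (EFin \o (fun=> c)).
  by apply: wdecr_integrable => x y _ _ _.
have iZ : mu.-integrable I01 (EFin \o (fun x => 2 * K * phi x)).
  have -> : EFin \o (fun x => 2 * K * phi x) = (fun x => (2 * K)%:E * (EFin \o phi) x)%E.
    by apply/funext => x; rewrite /= EFinM.
  exact: integrableZl.
have sqrE x : phi x ^+ 2 = psi x - 2 * K * phi x - K ^+ 2 by rewrite /psi; ring.
have iB : mu.-integrable I01 (EFin \o (fun x => psi x - 2 * K * phi x)).
  have -> : EFin \o (fun x => psi x - 2 * K * phi x) =
      ((EFin \o psi) \- (EFin \o (fun x => (2 * K * phi x)%R)))%E.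
    by apply/funext => x; rewrite /= EFinB.
  by apply: integrableB.
have intE : \int[mu]_(x in `[0, 1]) (phi x ^+ 2) =
    \int[mu]_(x in `[0, 1]) psi x - 2 * K * \int[mu]_(x in `[0, 1]) phi x - K ^+ 2.
  under eq_Rintegral do rewrite sqrE.
  rewrite RintegralB // RintegralB // RintegralZl // Rintegral_cst //.
  by rewrite /= lebesgue_measure_itv /= lte_fin ltr01 -EFinB /= subr0 mulr1.
exists ((psi 0 - psi 1) + 2 * K * (phi 0 - phi 1)) => N N0.
have N0' : N%:R != 0 :> R by rewrite pnatr_eq0 -lt0n.
have h1 := riemann_wdecr _ _ N0 d; have h2 := riemann_wdecr _ _ N0 dpsi.
have -> : avg N (fun j => phi (j.+1%:R / N%:R) ^+ 2) =
   avg N (fun j => psi (j.+1%:R / N%:R)) - 2 * K * avg N (fun j => phi (j.+1%:R / N%:R))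
   - K ^+ 2.
  rewrite /avg mulrA -mulrBl -[X in _ - X](mulfK N0') -mulrBl; congr (_ / _).
  have -> : K ^+ 2 * N%:R = \sum_(j < N) K ^+ 2 by rewrite sumr_const card_ord mulr_natr.
  rewrite mulr_sumr -!sumrB.
  by apply: eq_bigr => j _; exact: sqrE.
have K2 : 0 <= 2 * K by rewrite mulr_ge0 // addr_ge0.
rewrite intE; set a := avg N _ in h1 *; set b := avg N _ in h2 *.
set a' := \int[mu]_(x in _) _ in h1 *; set b' := \int[mu]_(x in _) _ in h2 *.
have -> : b - 2 * K * a - K ^+ 2 - (b' - 2 * K * a' - K ^+ 2) =
  (b - b') - 2 * K * (a - a') by ring.
apply: le_trans (ler_normB _ _) _; rewrite (mulrDl (psi 0 - psi 1)); apply: lerD => //.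
by rewrite normrM (ger0_norm K2) -[leRHS]mulrA ler_wpM2l.
Qed.

Lemma dist_cvg (u e : nat -> R) (l : R) :
  (\forall N \near \oo, `|u N - l| <= e N) -> e N @[N --> \oo] --> (0 : R) ->
  u N @[N --> \oo] --> l.
Proof.
move=> h he; apply/cvgrPdist_le => eps eps0.
move/cvgrPdist_le : he => /(_ _ eps0) he; near=> N.
rewrite distrC; apply: (@le_trans _ _ (e N)); first by near: N.
apply: le_trans (ler_norm _) _; rewrite -normrN -[- e N]add0r; by near: N.
Unshelve. all: by end_near. Qed.

Lemma cvg_divnat (D : R) : D / N%:R @[N --> \oo] --> (0 : R).
Proof.
rewrite -(mulr0 D); apply: cvgM; first exact: cvg_cst.
by rewrite -(cvg_shiftS); exact: cvg_harmonic.
Qed.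

End RiemannSums.

(** * Mean and variance of the positions *)

Section Profile.
Variable R : realType.
Local Notation mu := (@lebesgue_measure R).
Local Notation I01 := (`[0, 1]%classic : set R).
Implicit Type f : R -> R.

Definition position (N : nat) (lam : 'I_N -> int) (j : 'I_N) : R :=
  (shifted N lam j)%:~R / N%:R.

Definition position_mean (N : nat) (lam : 'I_N -> int) : R :=
  (\sum_j position N lam j) / N%:R.

Definition position_var (N : nat) (lam : 'I_N -> int) : R :=
  (\sum_j (position N lam j - position_mean N lam) ^+ 2) / N%:R.

(* The positions [l_j / N] are close to the values of [tilted f] at [j / N]. *)
Definition tilted f (x : R) : R := f x + (1 - x).

Lemma tilted_wdecr f : weakly_decreasing01 f -> weakly_decreasing01 (tilted f).
Proof. by move=> d x y x0 xy y1; rewrite lerD ?d // lerD2l lerN2. Qed.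

Lemma positionE (N : nat) (lam : 'I_N -> int) (j : 'I_N) :
  position N lam j = (lam j)%:~R / N%:R + (1 - j.+1%:R / N%:R).
Proof.
have N0 : N%:R != 0 :> R by rewrite pnatr_eq0 -lt0n (leq_ltn_trans _ (ltn_ord j)).
rewrite /position /shifted intrD mulrDl; congr (_ + _).
by rewrite -[X in X - _](divff N0) -mulrBl -natrB.
Qed.

Lemma sum_position_dist (N : nat) (lam : 'I_N -> int) f :
  \sum_j `|position N lam j - tilted f (j.+1%:R / N%:R)| = R_1 lam f.
Proof.
by apply: eq_bigr => j _; rewrite positionE /tilted; congr `|_|; ring.
Qed.

Lemma position_varE (N : nat) (lam : 'I_N -> int) : (0 < N)%N ->
  position_var N lam = (\sum_j position N lam j ^+ 2) / N%:R - position_mean N lam ^+ 2.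
Proof.
move=> N0; have N0' : N%:R != 0 :> R by rewrite pnatr_eq0 -lt0n.
rewrite /position_var; set m := position_mean N lam.
under eq_bigr do rewrite sqrrB.
rewrite big_split sumrB /= sumr_const card_ord -mulr_natr.
rewrite sumrMnl -mulr_suml.
have -> : \sum_i position N lam i = m * N%:R by rewrite /m /position_mean divfK.
by field.
Qed.

Lemma R_1_ge0 (N : nat) (lam : 'I_N -> int) f : 0 <= R_1 lam f.
Proof. by apply: sumr_ge0 => j _. Qed.

Lemma position_mean_dist (N : nat) (lam : 'I_N -> int) f :
  (0 < N)%N -> weakly_decreasing01 f ->
  `|position_mean N lam - \int[mu]_(x in `[0, 1]) tilted f x|
    <= (R_1 lam f + (tilted f 0 - tilted f 1)) / N%:R.
Proof.
move=> N0 d; have := riemann_wdecr _ _ _ N0 (tilted_wdecr _ d) => h.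
set I := Rintegral _ _ _ in h *.
have -> : position_mean N lam - I =
  (\sum_j (position N lam j - tilted f (j.+1%:R / N%:R))) / N%:R +
  (avg R N (fun j => tilted f (j.+1%:R / N%:R)) - I).
  by rewrite sumrB mulrBl /avg /position_mean addrA subrK.
apply: le_trans (ler_normD _ _) _; rewrite mulrDl; apply: lerD => //.
rewrite normrM normfV normr_nat ler_wpM2r ?invr_ge0 //.
by rewrite -sum_position_dist ler_norm_sum.
Qed.

(** Subtracting the mean of the zero signature removes the tilt [1 - x] term by term, so that only
    the Riemann error of [f] itself remains. *)
Lemma mean_lam_dist (N : nat) (lam : 'I_N -> int) f :
  (0 < N)%N -> weakly_decreasing01 f ->
  `|position_mean N lam - position_mean N (fun=> 0) - Efun f|
    <= (R_1 lam f + (f 0 - f 1)) / N%:R.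
Proof.
move=> N0 d; have := riemann_wdecr _ _ _ N0 d => h.
rewrite /Efun; set I := Rintegral _ _ _ in h *.
have -> : position_mean N lam - position_mean N (fun=> 0) - I =
  (\sum_(j < N) ((lam j)%:~R / N%:R - f (j.+1%:R / N%:R))) / N%:R +
  (avg R N (fun j => f (j.+1%:R / N%:R)) - I).
  rewrite sumrB mulrBl /avg /position_mean addrA subrK -mulrBl -sumrB.
  congr (_ / _ - _); apply: eq_bigr => j _; rewrite !positionE mul0r add0r.
  by rewrite addrK.
apply: le_trans (ler_normD _ _) _; rewrite mulrDl; apply: lerD => //.
by rewrite normrM normfV normr_nat ler_wpM2r ?invr_ge0 // ler_norm_sum.
Qed.

Lemma position_bounded f (C : R) (N : nat) (lam : 'I_N -> int) (j : 'I_N) :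
  weakly_decreasing01 f -> R_infty lam f <= C ->
  `|position N lam j - tilted f (j.+1%:R / N%:R)| <= C /\
  `|tilted f (j.+1%:R / N%:R)| <= `|tilted f 0| + `|tilted f 1|.
Proof.
move=> d hC; split.
  apply: le_trans hC; rewrite positionE /tilted.
  have -> : (lam j)%:~R / N%:R + (1 - j.+1%:R / N%:R) -
    (f (j.+1%:R / N%:R) + (1 - j.+1%:R / N%:R)) =
    (lam j)%:~R / N%:R - f (j.+1%:R / N%:R) by ring.
  exact: (le_bigmax _ (fun j : 'I_N => `|(lam j)%:~R / N%:R - f (j.+1%:R / N%:R)|)).
apply: wdecr_bounded (tilted_wdecr _ d) _ _; rewrite divr_ge0 //=.
by rewrite ler_pdivrMr ?mul1r ?ler_nat // ltr0n (leq_ltn_trans _ (ltn_ord j)).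
Qed.

Lemma cvg_invsqrt : (Num.sqrt N%:R)^-1 @[N --> \oo] --> (0 : R).
Proof.
have -> : (fun N : nat => (Num.sqrt N%:R)^-1 : R) = fun N => Num.sqrt (1 / N%:R).
  by apply/funext => N; rewrite div1r sqrtrV.
rewrite -(sqrtr0 R); apply: continuous_cvg; first exact: sqrt_continuous.
exact: cvg_divnat.
Qed.

Section Sequence.
Variables (lam : forall N : nat, 'I_N -> int) (f : R -> R) (C : R).
Hypothesis f_decr : weakly_decreasing01 f.
Hypothesis R_infty_bounded : forall N : nat, R_infty (lam N) f <= C.
Hypothesis R_1_small : R_1 (lam N) f / Num.sqrt N%:R @[N --> \oo] --> (0 : R).

Lemma mul_invsqrt (N : nat) : Num.sqrt N%:R * (N%:R)^-1 = (Num.sqrt N%:R)^-1 :> R.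
Proof.
case: N => [|N]; first by rewrite sqrtr0 mul0r invr0.
have s0 : Num.sqrt N.+1%:R != 0 :> R by rewrite sqrtr_eq0 -ltNge ltr0n.
by rewrite -[X in _ / X]sqr_sqrtr ?ler0n // expr2 invfM mulrA divff // mul1r.
Qed.

Lemma invn_le_invsqrt (N : nat) : N%:R^-1 <= (Num.sqrt N%:R)^-1 :> R.
Proof.
rewrite -mul_invsqrt; case: N => [|N]; first by rewrite sqrtr0 mul0r invr0.
rewrite ler_peMl ?invr_ge0 // -[leLHS]sqrtr1 ler_sqrt ?ler0n //.
by rewrite ler1n.
Qed.

Lemma cvg_R_1_const (D : R) :
  (R_1 (lam N) f + D) / Num.sqrt N%:R @[N --> \oo] --> (0 : R).
Proof.
have -> : (fun N : nat => (R_1 (lam N) f + D) / Num.sqrt N%:R) =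
  fun N => R_1 (lam N) f / Num.sqrt N%:R + D * (Num.sqrt N%:R)^-1.
  by apply/funext => N; rewrite mulrDl.
have -> : 0 = 0 + D * 0 :> R by rewrite mulr0 addr0.
apply: cvgD => //; apply: cvgM; [exact: cvg_cst|exact: cvg_invsqrt].
Qed.

Lemma cvg_mean_lam :
  Num.sqrt N%:R * (position_mean N (lam N) - position_mean N (fun=> 0) - Efun f)
    @[N --> \oo] --> (0 : R).
Proof.
apply: dist_cvg (cvg_R_1_const (f 0 - f 1)); near=> N.
have N0 : (0 < N)%N by near: N; exact: nbhs_infty_gt.
rewrite subr0 normrM ger0_norm ?sqrtr_ge0 //.
rewrite -mul_invsqrt mulrCA ler_wpM2l ?sqrtr_ge0 //.
exact: mean_lam_dist.
Unshelve. all: by end_near. Qed.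

Lemma cvg_position_var :
  position_var N (lam N) @[N --> \oo] -->
  \int[mu]_(x in `[0, 1]) (tilted f x ^+ 2) - (\int[mu]_(x in `[0, 1]) tilted f x) ^+ 2.
Proof.
have f0 : f 1 <= f 0 by exact: f_decr.
have cm : position_mean N (lam N) @[N --> \oo] --> \int[mu]_(x in `[0, 1]) tilted f x.
  apply: dist_cvg (cvg_R_1_const (tilted f 0 - tilted f 1)); near=> N.
  have N0 : (0 < N)%N by near: N; exact: nbhs_infty_gt.
  apply: le_trans (position_mean_dist _ _ _ N0 f_decr) _.
  rewrite ler_wpM2l ?invn_le_invsqrt // addr_ge0 ?R_1_ge0 // /tilted.
  by rewrite subr0 subrr addr0; lra.
pose K := `|tilted f 0| + `|tilted f 1|.
have K0 : 0 <= K by rewrite addr_ge0.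
(* At [N = 0] the maximum is empty and takes its default value 0. *)
have C0 : 0 <= C.
  by apply: le_trans (R_infty_bounded 0); rewrite /R_infty big_ord0.
have CK : 0 <= C + 2 * K by rewrite addr_ge0 // mulr_ge0.
have [D hD] := riemann_sqr _ _ (tilted_wdecr _ f_decr).
have cs : (\sum_j position N (lam N) j ^+ 2) / N%:R @[N --> \oo] -->
    \int[mu]_(x in `[0, 1]) (tilted f x ^+ 2).
  have lim0 : (C + 2 * K) * (R_1 (lam N) f / Num.sqrt N%:R) + D / N%:R
      @[N --> \oo] --> (0 : R).
    have -> : 0 = (C + 2 * K) * 0 + 0 :> R by rewrite mulr0 addr0.
    apply: cvgD; last exact: cvg_divnat.
    by apply: cvgM => //; exact: cvg_cst.
  apply: dist_cvg lim0; near=> N.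
  have N0 : (0 < N)%N by near: N; exact: nbhs_infty_gt.
  set I := Rintegral _ _ _ in hD *; have := hD N N0 => h.
  set g := fun j : nat => tilted f (j.+1%:R / N%:R).
  have -> : (\sum_j position N (lam N) j ^+ 2) / N%:R - I =
    (\sum_(j < N) (position N (lam N) j ^+ 2 - g j ^+ 2)) / N%:R +
    (avg R N (fun j => g j ^+ 2) - I) by rewrite sumrB mulrBl /avg addrA subrK.
  apply: le_trans (ler_normD _ _) _; apply: lerD => //.
  rewrite normrM normfV normr_nat.
  apply: (@le_trans _ _ (((C + 2 * K) * R_1 (lam N) f) / N%:R)); last first.
    by rewrite -mulrA ler_wpM2l // ler_wpM2l ?R_1_ge0 // invn_le_invsqrt.
  rewrite ler_wpM2r ?invr_ge0 // -sum_position_dist mulr_sumr.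
  apply: le_trans (ler_norm_sum _ _ _) _; apply: ler_sum => j _.
  have [h1 h2] := position_bounded _ _ _ _ j f_decr (R_infty_bounded N).
  rewrite -/(g j) -/K in h1 h2 *.
  (* A difference of squares: the first factor is bounded through [R_infty], and the second sums to
     [R_1]. *)
  have -> : position N (lam N) j ^+ 2 - g j ^+ 2 =
    ((position N (lam N) j - g j) + 2 * g j) * (position N (lam N) j - g j) by ring.
  rewrite normrM ler_wpM2r // (le_trans (ler_normD _ _)) // lerD //.
  by rewrite normrM ger0_norm // ler_wpM2l.
have c2 : (\sum_j position N (lam N) j ^+ 2) / N%:R - position_mean N (lam N) ^+ 2
    @[N --> \oo] --> \int[mu]_(x in `[0, 1]) (tilted f x ^+ 2)
    - (\int[mu]_(x in `[0, 1]) tilted f x) ^+ 2.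
  by apply: cvgB => //; rewrite expr2; under eq_fun do rewrite expr2; apply: cvgM.
apply: cvg_trans c2; apply: near_eq_cvg; near=> N; rewrite position_varE //.
by near: N; exact: nbhs_infty_gt.
Unshelve. all: by end_near. Qed.

End Sequence.

End Profile.

Section Variance.
Variable R : realType.
Local Notation mu := (@lebesgue_measure R).
Local Notation I01 := (`[0, 1]%classic : set R).

(** The squares of [1 - x] cancel, and the cross terms are twice the covariance of [f] with [1 - x],
    that is [2 int f (1 - x) - E(f) = int f (1 - 2 x)]. *)
Lemma Sfun_tilted (f : R -> R) : weakly_decreasing01 f ->
  Sfun f =
  (\int[mu]_(x in `[0, 1]) (tilted R f x ^+ 2) - (\int[mu]_(x in `[0, 1]) tilted R f x) ^+ 2)
  - (\int[mu]_(x in `[0, 1]) (tilted R (fun=> 0) x ^+ 2)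
     - (\int[mu]_(x in `[0, 1]) tilted R (fun=> 0) x) ^+ 2).
Proof.
move=> d; set t0 := tilted R (fun=> 0).
have d0 : weakly_decreasing01 t0 by apply: tilted_wdecr => x y _ _ _.
have t0E x : t0 x = 1 - x by rewrite /t0 /tilted add0r.
have mf := wdecr_measurable _ _ d; have mt := wdecr_measurable _ _ d0.
have bf := wdecr_bounded _ _ d; have bt := wdecr_bounded _ _ d0.
have iM (g h : R -> R) (G H : R) : measurable_fun I01 g -> measurable_fun I01 h ->
    (forall x, 0 <= x <= 1 -> `|g x| <= G) -> (forall x, 0 <= x <= 1 -> `|h x| <= H) ->
    mu.-integrable I01 (EFin \o (fun x => g x * h x)).
  move=> mg mh bg bh; apply: (bounded_integrable01 _ _ (G * H)).
    exact: measurable_funM.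
  by move=> x x01; rewrite normrM ler_pM ?bg ?bh.
have iff := iM _ _ _ _ mf mf bf bf; have itt := iM _ _ _ _ mt mt bt bt.
have ift := iM _ _ _ _ mf mt bf bt.
have if1 := wdecr_integrable _ _ d; have it1 := wdecr_integrable _ _ d0.
have mI : measurable (I01 : set R) by [].
have iZ (c : R) (g : R -> R) : mu.-integrable I01 (EFin \o g) ->
    mu.-integrable I01 (EFin \o (fun x => c * g x)).
  move=> ig; have -> : EFin \o (fun x => c * g x) = (fun x => c%:E * (EFin \o g) x)%E.
    by apply/funext => x; rewrite /= EFinM.
  exact: integrableZl.
have iD (g h : R -> R) : mu.-integrable I01 (EFin \o g) ->
    mu.-integrable I01 (EFin \o h) -> mu.-integrable I01 (EFin \o (fun x => g x + h x)).
  move=> ig ih; have -> : EFin \o (fun x => g x + h x) = ((EFin \o g) \+ (EFin \o h))%E.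
    by apply/funext => x; rewrite /= EFinD.
  by apply: integrableD.
have half : \int[mu]_(x in `[0, 1]) t0 x = 2^-1.
  rewrite -(@Rintegral_onemXn R 1); apply: eq_Rintegral => x _.
  by rewrite t0E expr1.
have e1 : \int[mu]_(x in `[0, 1]) tilted R f x = \int[mu]_(x in `[0, 1]) f x + 2^-1.
  by rewrite -half -RintegralD //; apply: eq_Rintegral => x _; rewrite t0E.
have e2 : \int[mu]_(x in `[0, 1]) (tilted R f x ^+ 2) =
    \int[mu]_(x in `[0, 1]) (f x * f x) + 2 * \int[mu]_(x in `[0, 1]) (f x * t0 x)
    + \int[mu]_(x in `[0, 1]) (t0 x * t0 x).
  rewrite -RintegralZl // -RintegralD //; last exact: iZ.
  rewrite -RintegralD //; last by apply: iD => //; exact: iZ.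
  by apply: eq_Rintegral => x _; rewrite t0E /tilted; ring.
have e3 : \int[mu]_(x in `[0, 1]) (f x * (1 - 2 * x)) =
    2 * \int[mu]_(x in `[0, 1]) (f x * t0 x) + (-1) * \int[mu]_(x in `[0, 1]) f x.
  rewrite -!RintegralZl // -RintegralD //; try exact: iZ.
  by apply: eq_Rintegral => x _; rewrite t0E; ring.
have e4 (g : R -> R) : \int[mu]_(x in `[0, 1]) (g x ^+ 2) =
    \int[mu]_(x in `[0, 1]) (g x * g x).
  by apply: eq_Rintegral => x _; rewrite expr2.
by rewrite /Sfun /Efun e3 e2 e1 half !e4; field.
Qed.

End Variance.

(** * Logarithm near 1 and exponential near 0 *)

Section ComplexLog.
Variable R : realType.
Implicit Types z w : R[i].

(* Principal logarithm, meaningful for [0 < Re w]. *)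
Definition clog w : R[i] := ln (normc w) +i* atan (complex.Im w / complex.Re w).

Lemma clogK w : 0 < complex.Re w -> cexp (clog w) = w.
Proof.
case: w => a b /= a0; rewrite /cexp /clog /=.
set t := b / a; have s0 : 0 < 1 + t ^+ 2 by rewrite ltr_pwDl ?sqr_ge0.
have sq0 : Num.sqrt (1 + t ^+ 2) != 0 by rewrite sqrtr_eq0 -ltNge.
have rE : Num.sqrt (a ^+ 2 + b ^+ 2) = a * Num.sqrt (1 + t ^+ 2).
  rewrite -[X in X * _](ger0_norm (ltW a0)) -sqrtr_sqr -sqrtrM ?sqr_ge0 //.
  by congr Num.sqrt; rewrite mulrDr mulr1 -exprMn /t mulrCA divff ?mulr1 ?lt0r_neq0.
rewrite lnK ?posrE; last by rewrite rE mulr_gt0 // lt_def sq0 sqrtr_ge0.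
have sin_atan : sin (atan t) = t * (Num.sqrt (1 + t ^+ 2))^-1.
  by rewrite -cos_atan -[X in X * _](atanK t) /tan divfK // cos_atan invr_eq0.
rewrite mul_realc cos_atan sin_atan rE mulfK //; congr (_ +i* _).
by rewrite mulrACA divff // mulr1 /t mulrCA divff ?mulr1 // lt0r_neq0.
Qed.

Lemma clog_small (e : R) : 0 < e -> exists2 d : R, 0 < d & forall w,
  normc (w - 1) <= d -> 0 < complex.Re w /\ normc (clog w) <= e.
Proof.
move=> e0; have e2 : 0 < e / 2 by rewrite divr_gt0.
have /cvgrPdist_le /(_ _ e2) /nbhs_ballP [d1 /= d10 h1] := @continuous_ln R 1 ltr01.
have /cvgrPdist_le /(_ _ e2) /nbhs_ballP [d2 /= d20 h2] := @continuous_atan R 0.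
(* The bound [1/2] forces [Re w >= 1/2], and then [|Im w| <= d2 / 4] puts the argument of [atan]
   below [d2]. *)
exists (Num.min (d1 / 2) (Num.min (d2 / 4) (1 / 2))).
  by rewrite !lt_min !divr_gt0.
move=> w; rewrite !le_min => /and3P[hd1 hd2 hd3].
have hre : `|complex.Re w - 1| <= normc (w - 1).
  by have := ler_normc_Re R (w - 1); case: w {hd1 hd2 hd3} => a b.
have him : `|complex.Im w| <= normc (w - 1).
  by have := ler_normc_Im R (w - 1); case: w {hd1 hd2 hd3 hre} => a b; rewrite /= subr0.
have re2 : 1 / 2 <= complex.Re w.
  by move: (le_trans hre hd3); rewrite ler_norml => /andP[? _]; lra.
have re0 : 0 < complex.Re w by apply: lt_le_trans re2; rewrite divr_gt0.
split; first exact: re0.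
apply: le_trans (normc_le_ReIm R (clog w)) _; rewrite [leRHS]splitr /=.
apply: lerD.
  rewrite -normrN -sub0r -(@ln1 R); apply: h1; rewrite /ball /=.
  apply: (@le_lt_trans _ _ (normc (w - 1))); last first.
    by apply: le_lt_trans hd1 _; rewrite ltr_pdivrMr // ltr_pMr // ltr1n.
  have := normc_add R (w - 1) 1; have := normc_add R (1 - w) w.
  rewrite !subrK normc1 (normc_subC _ 1) => k1 k2.
  by rewrite ler_norml; apply/andP; split; lra.
rewrite -normrN -sub0r -(@atan0 R); apply: h2; rewrite /ball /= sub0r normrN.
rewrite normrM normfV (gtr0_norm re0) ltr_pdivrMr //.
apply: le_lt_trans him _; apply: le_lt_trans hd2 _.
by apply: (@lt_le_trans _ _ (d2 * (1 / 2))); [lra | rewrite ler_wpM2l // ltW].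
Qed.

Lemma cexp_small (e : R) : 0 < e -> exists2 d : R, 0 < d & forall v : R[i],
  normc v <= d -> normc (cexp v - 1) <= e.
Proof.
move=> e0; have e3 : 0 < e / 3 by rewrite divr_gt0.
have /cvgrPdist_le /(_ _ e3) /nbhs_ballP [d1 /= d10 h1] := @continuous_expR R 0.
have /cvgrPdist_le /(_ _ e3) /nbhs_ballP [d2 /= d20 h2] := @continuous_cos R 0.
have /cvgrPdist_le /(_ _ e3) /nbhs_ballP [d3 /= d30 h3] := @continuous_sin R 0.
exists (Num.min (d1 / 2) (Num.min (d2 / 2) (d3 / 2))).
  by rewrite !lt_min !divr_gt0.
move=> v; rewrite !le_min => /and3P[hd1 hd2 hd3].
have hre := ler_normc_Re R v; have him := ler_normc_Im R v.
have half (x y d : R) : `|x| <= y -> y <= d / 2 -> 0 < d -> `|0 - x| < d.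
  by rewrite sub0r normrN => *; lra.
have {h1} := h1 _ (half _ _ _ hre hd1 d10); have {h2} := h2 _ (half _ _ _ him hd2 d20).
have {h3} := h3 _ (half _ _ _ him hd3 d30); rewrite expR0 cos0 sin0.
set a := complex.Re v; set b := complex.Im v => h3 h2 h1.
suff : normc ((expR a)%:C * (cos b +i* sin b) - 1) <= e by [].
have -> : (expR a)%:C * (cos b +i* sin b) - 1 =
  (expR a - 1)%:C * (cos b +i* sin b) + ((cos b - 1) +i* sin b).
  rewrite !mul_realc -[LHS]/(_ +i* _) -[RHS]/(_ +i* _).
  by congr (_ +i* _); ring.
apply: le_trans (normc_add _ _ _) _; rewrite normcM normc_real.
rewrite [normc (cos b +i* sin b)]/= cos2Dsin2 sqrtr1 mulr1.
have := normc_le_ReIm R ((cos b - 1) +i* sin b); rewrite /=.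
rewrite distrC in h1; rewrite distrC in h2; rewrite sub0r normrN in h3.
by move=> h4; apply: le_trans (lerD h1 (le_trans h4 (lerD h2 h3))) _; lra.
Qed.

End ComplexLog.

(** * Proof of the asymptotics *)

Section Assembly.
Variable R : realType.
Implicit Types (h y : R[i]).

(** An affine change of nodes: the translation comes out as [cexp (y * c)], and each of the [n]
    factors of a denominator gains a [y]. The power [y^n] does not depend on [l] and cancels in
    [schur_normalized_ratio]. *)
Lemma divdiff_shifted (n : nat) (l : 'I_n.+1 -> int) y (c : R[i]) :
  injective l -> y != 0 ->
  \sum_j cexp y ^ l j / \prod_(i | i != j) ((l j)%:~R - (l i)%:~R) =
  cexp (y * c) * y ^+ n *
    divdiff R[i] [seq y * ((l j)%:~R - c) | j <- enum 'I_n.+1] (@cexp R).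
Proof.
move=> il y0; pose w j := y * ((l j)%:~R - c).
have iw i j : (w i == w j) = (i == j).
  apply/eqP/eqP => [/(mulfI y0)/addIr/eqP|->//].
  by rewrite eqr_int => /eqP /il.
have wB i j : w j - w i = y * ((l j)%:~R - (l i)%:~R) by rewrite /w; ring.
rewrite /divdiff big_map big_enum mulr_sumr; apply: eq_bigr => j _.
rewrite big_map big_enum_cond /=.
under [in RHS]eq_bigl do rewrite -/(w _) -/(w _) iw.
under [in RHS]eq_bigr do rewrite -/(w _) -/(w _) wB.
rewrite big_split /= prodr_const cardC1 card_ord.
rewrite cexpXz -[y * (l j)%:~R](subrK (y * c)) -mulrBr -/(w j) cexpD.
rewrite invfM; set P := (\prod_(i | _) _)^-1.
have yn : y ^+ n != 0 by rewrite expf_neq0.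
rewrite [in RHS]mulrACA [y ^+ n * _]mulrA divff // mul1r.
by rewrite [cexp (w j) * _]mulrC mulrA.
Qed.

Definition centered_points (N : nat) (lam : 'I_N -> int) h : seq R[i] :=
  [seq h * ((position R N lam j - position_mean R N lam) / Num.sqrt N%:R)%:C
    | j <- enum 'I_N].

Lemma size_centered_points (N : nat) (lam : 'I_N -> int) h :
  size (centered_points N lam h) = N.
Proof. by rewrite size_map size_enum_ord. Qed.

Lemma powsum_centered_points (N : nat) (lam : 'I_N -> int) h (m : nat) :
  powsum R[i] (centered_points N lam h) m =
  h ^+ m * (\sum_j ((position R N lam j - position_mean R N lam) / Num.sqrt N%:R) ^+ m)%:C.
Proof.
rewrite /powsum big_map big_enum rmorph_sum mulr_sumr.
by apply: eq_bigr => j _; rewrite exprMn rmorphXn.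
Qed.

Lemma powsum1_centered_points (N : nat) (lam : 'I_N -> int) h :
  (0 < N)%N -> powsum R[i] (centered_points N lam h) 1 = 0.
Proof.
move=> N0; have N0' : N%:R != 0 :> R by rewrite pnatr_eq0 -lt0n.
rewrite powsum_centered_points (_ : \sum_j _ = 0) ?mulr0 //.
under eq_bigr do rewrite expr1.
rewrite -mulr_suml sumrB sumr_const card_ord -[X in _ - X]mulr_natr.
by rewrite /position_mean divfK // subrr mul0r.
Qed.

Lemma powsum2_centered_points (N : nat) (lam : 'I_N -> int) h :
  powsum R[i] (centered_points N lam h) 2 = h ^+ 2 * (position_var R N lam)%:C.
Proof.
rewrite powsum_centered_points; congr (_ * _%:C); rewrite /position_var mulr_suml.
by apply: eq_bigr => j _; rewrite expr_div_n sqr_sqrtr ?ler0n.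
Qed.

(** There are [N] points of modulus at most [H M / sqrt N]; their number absorbs two of the [m + 2]
    factors [1 / sqrt N]. *)
Lemma powsum_centered_points_le (N : nat) (lam : 'I_N -> int) h (H M : R) (m : nat) :
  (0 < N)%N -> normc h <= H ->
  (forall j, `|position R N lam j - position_mean R N lam| <= M) ->
  normc (powsum R[i] (centered_points N lam h) m.+2) <=
  (H * M) ^+ 2 * (H * M / Num.sqrt N%:R) ^+ m.
Proof.
move=> N0 hH hM; have s0 : 0 < Num.sqrt N%:R :> R by rewrite sqrtr_gt0 ltr0n.
have H0 : 0 <= H by apply: le_trans hH; exact: normc_ge0.
have M0 : 0 <= M by apply: le_trans (hM (Ordinal N0)).
rewrite powsum_centered_points normcM normcX normc_real.
have -> : (H * M) ^+ 2 * (H * M / Num.sqrt N%:R) ^+ m =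
    H ^+ m.+2 * (N%:R * (M / Num.sqrt N%:R) ^+ m.+2).
  have gen (r : R) : r != 0 ->
      (H * M) ^+ 2 * (H * M / r) ^+ m = H ^+ m.+2 * (r ^+ 2 * (M / r) ^+ m.+2).
    move=> r0; rewrite !exprMn !exprS !expr0 !mulr1.
    by field; rewrite r0.
  by rewrite gen ?lt0r_neq0 // sqr_sqrtr ?ler0n.
apply: ler_pM; rewrite ?exprn_ge0 ?normc_ge0 //.
  by rewrite lerXn2r ?nnegrE ?normc_ge0.
apply: le_trans (ler_norm_sum _ _ _) _.
apply: (@le_trans _ _ (\sum_(j < N) (M / Num.sqrt N%:R) ^+ m.+2)).
  apply: ler_sum => j _; rewrite normrX lerXn2r ?nnegrE ?divr_ge0 ?sqrtr_ge0 //.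
  by rewrite normrM normfV (gtr0_norm s0) ler_wpM2r ?invr_ge0 ?sqrtr_ge0.
by rewrite sumr_const card_ord mulr_natl.
Qed.

Lemma centered_points_scaled (n : nat) (lam : 'I_n.+1 -> int) h :
  [seq n.+1%:R * x | x <- centered_points n.+1 lam h] =
  [seq h / (Num.sqrt n.+1%:R)%:C *
    ((shifted n.+1 lam j)%:~R - (n.+1%:R * position_mean R n.+1 lam)%:C)
    | j <- enum 'I_n.+1].
Proof.
rewrite -map_comp; apply: eq_map => j /=.
have -> : (shifted n.+1 lam j)%:~R = (n.+1%:R * position R n.+1 lam j)%:C :> R[i].
  by rewrite /position mulrCA divff ?pnatr_eq0 // mulr1 rmorph_int.
rewrite -rmorphB -mulrBr -(rmorph_nat (real_complex R)) -!fmorphV.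
by rewrite !rmorphM; ring.
Qed.

Lemma uniq_centered_points (n : nat) (lam : 'I_n.+1 -> int) h :
  signature lam -> h != 0 -> uniq (centered_points n.+1 lam h).
Proof.
move=> hl h0; rewrite map_inj_uniq ?enum_uniq // => i j /(mulfI h0).
move=> /(congr1 (@complex.Re R)) /=.
have s0 : (Num.sqrt n.+1%:R)^-1 != 0 :> R by rewrite invr_eq0 sqrtr_eq0 -ltNge ltr0n.
move=> /(mulIf s0)/addIr; rewrite /position.
have N0 : n.+1%:R^-1 != 0 :> R by rewrite invr_eq0 pnatr_eq0.
by move=> /(mulIf N0)/eqP; rewrite eqr_int => /eqP /(shifted_inj _ _ hl).
Qed.

(* The denominator [(x - 1)^n] of [S_lam(x)] is the same divided difference for
   [lam = 0], so that it never has to be expanded. *)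
Lemma schur_normalized_ratio (n : nat) (lam : 'I_n.+1 -> int) h :
  signature lam -> h != 0 -> let y := h / (Num.sqrt n.+1%:R)%:C in
  schur_normalized lam (cexp y) *
    (cexp (y * (n.+1%:R * position_mean R n.+1 (fun=> 0))%:C) *
      centered_sum R (centered_points n.+1 (fun=> 0) h)) =
  cexp (y * (n.+1%:R * position_mean R n.+1 lam)%:C) *
    centered_sum R (centered_points n.+1 lam h).
Proof.
move=> hl h0 y.
have y0 : y != 0.
  rewrite mulf_neq0 // invr_eq0 -(rmorph0 (real_complex R)).
  by rewrite (inj_eq (@complexI R)) sqrtr_eq0 -ltNge ltr0n.
have hz : signature (fun _ : 'I_n.+1 => 0) by [].
have csE (mu : 'I_n.+1 -> int) : signature mu ->
    n`!%:R * \sum_j cexp y ^ shifted n.+1 mu j /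
      \prod_(i | i != j) ((shifted n.+1 mu j)%:~R - (shifted n.+1 mu i)%:~R) =
    y ^+ n * (cexp (y * (n.+1%:R * position_mean R n.+1 mu)%:C) *
      centered_sum R (centered_points n.+1 mu h)).
  move=> hmu; rewrite /centered_sum size_centered_points /= centered_points_scaled.
  rewrite (divdiff_shifted _ _ _ (n.+1%:R * position_mean R n.+1 mu)%:C
    (shifted_inj _ _ hmu) y0).
  by rewrite -/y; ring.
have [+ _] := schur_normalized_expansion R[i] n lam (cexp y) hl (cexp_neq0 _ _).
rewrite (vandermonde_expansion R[i]).
have -> : \sum_(j < n.+1) cexp y ^ (n.+1 - j.+1)%N%:Z /
      \prod_(i < n.+1 | i != j) ((n.+1 - j.+1)%N%:~R - (n.+1 - i.+1)%N%:~R) =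
    \sum_j cexp y ^ shifted n.+1 (fun=> 0) j /
      \prod_(i | i != j) ((shifted n.+1 (fun=> 0) j)%:~R - (shifted n.+1 (fun=> 0) i)%:~R).
  by apply: eq_bigr => j _; rewrite /shifted add0r; under [in RHS]eq_bigr do rewrite add0r.
rewrite !csE // mulrCA => /mulfI; apply.
by rewrite expf_neq0.
Qed.

(** With relative errors, [c = exp(g) (1 + a)] and [c0 = exp(g0) (1 + b)], the quotient is
    [U (1 + a) / (1 + b)] with [U] close to 1. As [e <= 1/2], [1 + b] stays away from 0 and the
    error is at most [2 (3/2 + 2) e = 7 e]. *)
Lemma ratio_close (S A A0 g g0 m c c0 : R[i]) (e : R) : e <= 1 / 2 ->
  S * (cexp A0 * c0) = cexp A * c ->
  normc ((c - cexp g) * cexp (- g)) <= e ->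
  normc ((c0 - cexp g0) * cexp (- g0)) <= e ->
  normc (cexp (A - A0 + g - g0 - m) - 1) <= e ->
  normc (S / cexp m - 1) <= 8 * e.
Proof.
move=> e12 eq ha hb hu; set a := _ * cexp (- g) in ha; set b := _ * cexp (- g0) in hb.
set U := cexp (_ - _) in hu; have e0 : 0 <= e by apply: le_trans ha; exact: normc_ge0.
have fact (v q : R[i]) : v = cexp q * (1 + (v - cexp q) * cexp (- q)).
  by rewrite cexpNV; field; exact: cexp_neq0.
have cE : c = cexp g * (1 + a) := fact c g.
have c0E : c0 = cexp g0 * (1 + b) := fact c0 g0.
pose w := S / cexp m; rewrite -/w.
have wE : w * (1 + b) = U * (1 + a).
  have nz := cexp_neq0 R.
  apply: (mulIf (nz (m + A0 + g0))); rewrite /U.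
  have -> : cexp (A - A0 + g - g0 - m) * (1 + a) * cexp (m + A0 + g0) =
     cexp A * (cexp g * (1 + a)).
    rewrite mulrAC -cexpD mulrA -cexpD; congr (cexp _ * _); ring.
  rewrite -cE -eq c0E /w !cexpD; field; exact: nz.
have w1 : (w - 1) * (1 + b) = (U - 1) * (1 + a) + (a - b).
  by rewrite mulrBl wE; ring.
have na : normc (1 + a) <= 3 / 2.
  by apply: le_trans (normc_add _ _ _) _; rewrite normc1; lra.
have nb : 1 / 2 <= normc (1 + b).
  have := normc_sub R (1 + b) b; rewrite addrK normc1 => k; lra.
have k1 : normc ((w - 1) * (1 + b)) <= e * (3 / 2) + (e + e).
  rewrite w1; apply: le_trans (normc_add _ _ _) _; rewrite normcM; apply: lerD.
    by apply: ler_pM; rewrite ?normc_ge0.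
  by apply: le_trans (normc_sub _ _ _) _; apply: lerD.
have k2 : normc (w - 1) * (1 / 2) <= normc ((w - 1) * (1 + b)).
  by rewrite normcM ler_wpM2l ?normc_ge0.
lra.
Qed.

Lemma position_dev_bounded f (C : R) (N : nat) (lam : 'I_N -> int) :
  weakly_decreasing01 f -> R_infty lam f <= C ->
  forall j, `|position R N lam j - position_mean R N lam| <=
    2 * (C + (`|tilted R f 0| + `|tilted R f 1|)).
Proof.
move=> d hC j; set M := C + _.
have pM i : `|position R N lam i| <= M.
  have [h1 h2] := position_bounded R f C N lam i d hC.
  rewrite -[position R N lam i](subrK (tilted R f (i.+1%:R / N%:R))).
  by apply: le_trans (ler_normD _ _) _; apply: lerD.
have N0 : 0 < N%:R :> R by rewrite ltr0n (leq_ltn_trans _ (ltn_ord j)).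
have mM : `|position_mean R N lam| <= M.
  rewrite normrM normfV normr_nat ler_pdivrMr //.
  apply: le_trans (ler_norm_sum _ _ _) _.
  apply: (@le_trans _ _ (\sum_(i < N) M)); first by apply: ler_sum => i _.
  by rewrite sumr_const card_ord mulr_natr.
by apply: le_trans (ler_normB _ _) _; have := pM j; lra.
Qed.

Lemma near_invsqrt (k e : R) : 0 < e ->
  \forall N \near \oo, k * (Num.sqrt N%:R)^-1 <= e.
Proof.
move=> e0; have : k * (Num.sqrt N%:R)^-1 @[N --> \oo] --> (0 : R).
  by rewrite -(mulr0 k); apply: cvgM; [exact: cvg_cst|exact: cvg_invsqrt].
move=> /cvgrPdist_le /(_ _ e0); apply: filterS => N /=.
by rewrite sub0r normrN; apply: le_trans; exact: ler_norm.
Qed.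

End Assembly.

Section Close.
Variables (R : realType) (lam : forall N : nat, 'I_N -> int) (f : R -> R) (C : R).
Hypothesis lam_sig : forall N : nat, signature (lam N).
Hypothesis f_decr : weakly_decreasing01 f.
Hypothesis R_infty_bounded : forall N : nat, R_infty (lam N) f <= C.
Hypothesis R_1_small : R_1 (lam N) f / Num.sqrt N%:R @[N --> \oo] --> (0 : R).

Definition normalized_ratio (N : nat) (h : R[i]) : R[i] :=
  schur_normalized (lam N) (cexp (h / (Num.sqrt N%:R)%:C)) /
  cexp ((Num.sqrt N%:R * Efun f)%:C * h + 1 / 2 * (Sfun f)%:C * h ^+ 2).

(** The zero signature with profile 0 satisfies the same hypotheses, so the denominator is covered
    by the results for [lam]. *)
Let zero_lam (N : nat) (i : 'I_N) : int := 0.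

Let zero_wdecr : weakly_decreasing01 (fun=> 0 : R).
Proof. by []. Qed.

Let R_infty_zero (N : nat) : R_infty (zero_lam N) (fun=> 0 : R) <= 0.
Proof. by apply: bigmax_le => // j _; rewrite mul0r subr0 normr0. Qed.

Lemma cvg_var_diff :
  position_var R N (lam N) - position_var R N (zero_lam N) @[N --> \oo] --> Sfun f.
Proof.
rewrite (Sfun_tilted _ _ f_decr); apply: cvgB.
  exact: (cvg_position_var _ _ _ _ f_decr R_infty_bounded).
apply: (cvg_position_var _ _ _ _ zero_wdecr R_infty_zero).
have -> : (fun N => R_1 (zero_lam N) (fun=> 0 : R) / Num.sqrt N%:R) = (fun=> 0).
  apply/funext => N; rewrite /R_1 big1 ?mul0r // => j _.
  by rewrite mul0r subr0 normr0.
exact: cvg_cst.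
Qed.

Lemma normalized_ratio_close (H e : R) : 1 <= H -> 0 < e -> e <= 1 / 2 ->
  \forall N \near \oo, forall h, normc h <= H ->
    normc (normalized_ratio N h - 1) <= 8 * e.
Proof.
move=> H1 e0 e12; have H0 : 0 < H by apply: lt_le_trans H1.
pose K := `|tilted R f 0| + `|tilted R f 1|.
pose K0 := `|tilted R (fun=> 0) 0| + `|tilted R (fun=> 0) 1|.
have C0 : 0 <= C by apply: le_trans (R_infty_bounded 0); rewrite /R_infty big_ord0.
have Kp : 0 <= K by rewrite addr_ge0.
have K0p : 0 <= K0 by rewrite addr_ge0.
pose M := 2 * (C + K) + 2 * (0 + K0).
have M0 : 0 <= M by rewrite /M; lra.
have dev N j : `|position R N (lam N) j - position_mean R N (lam N)| <= M.
  apply: le_trans (position_dev_bounded _ _ _ _ _ f_decr (R_infty_bounded N) j) _.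
  by rewrite -/K /M; lra.
have dev0 N j : `|position R N (zero_lam N) j - position_mean R N (zero_lam N)| <= M.
  apply: le_trans (position_dev_bounded _ _ _ _ _ zero_wdecr (R_infty_zero N) j) _.
  by rewrite -/K0 /M; lra.
pose B := (H * M) ^+ 2; have B0 : 0 <= B by rewrite exprn_ge0 // mulr_ge0 // ltW.
have [D D0 hD] := centered_sum_estimate R B B0.
have [d d0 hd] := cexp_small R e e0.
(* The errors of mean and variance enter the exponent with [h] and [h^2 / 2]; since [H >= 1], [H^2]
   bounds both [|h|] and [|h|^2]. *)
have d2 : 0 < d / (2 * H ^+ 2) by rewrite divr_gt0 // mulr_gt0 // exprn_gt0.
have nm := cvg_mean_lam R lam f f_decr R_1_small.
have nv := cvg_var_diff.
move/cvgrPdist_le : nm => /(_ _ d2) nm; move/cvgrPdist_le : nv => /(_ _ d2) nv.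
have nq := near_invsqrt R (H * M) (1 / 4) ltac:(by rewrite divr_gt0).
(* The estimate gives [D (H M / sqrt N + 1 / N)] with [1 / N <= 1 / sqrt N]; [expR B] bounds
   [exp(- g)] and turns it into a relative error. *)
have hDn := near_invsqrt R (expR B * D * (H * M + 1)) e e0.
apply: filterS (filterI nm (filterI nv (filterI nq (filterI hDn (nbhs_infty_gt 0))))).
move=> N [/= hm [hv [hq [hD' N0]]]].
move=> h hH; case: N N0 hm hv hq hD' => // n _ hm hv hq hD'; set N := n.+1 in hm hv hq hD' *.
have s0 : 0 < Num.sqrt N%:R :> R by rewrite sqrtr_gt0 ltr0n.
have sC : (Num.sqrt N%:R)%:C != 0 :> R[i].
  by rewrite -(rmorph0 (real_complex R)) (inj_eq (@complexI R)) lt0r_neq0.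
have [-> | h0] := eqVneq h 0.
  rewrite /normalized_ratio mul0r cexp0 expr0n /= !mulr0 addr0 cexp0 divr1.
  have [_ ->] := schur_normalized_expansion R[i] n (lam N) 1 (lam_sig N) (oner_neq0 _).
  by rewrite subrr normc0 mulr_ge0 // ltW.
have est (mu : 'I_N -> int) : signature mu ->
    (forall j, `|position R N mu j - position_mean R N mu| <= M) ->
    normc ((centered_sum R (centered_points R N mu h)
      - cexp (powsum R[i] (centered_points R N mu h) 2 / 2))
      * cexp (- (powsum R[i] (centered_points R N mu h) 2 / 2))) <= e.
  move=> hmu devmu; set s := centered_points R N mu h; set g := _ / 2.
  have pm m : normc (powsum R[i] s m.+2) <= B * (H * M / Num.sqrt N%:R) ^+ m.
    exact: powsum_centered_points_le.
  have qq : 0 <= H * M / Num.sqrt N%:R <= 1 / 4.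
    by rewrite hq andbT divr_ge0 ?sqrtr_ge0 // mulr_ge0 // ltW.
  have us : uniq s by exact: uniq_centered_points.
  have p1 : powsum R[i] s 1 = 0 by exact: powsum1_centered_points.
  have sz : size s = N by exact: size_centered_points.
  have := hD s _ qq us _ p1 pm; rewrite sz => /(_ (ltn0Sn n)) hc.
  have gB : normc (cexp (- g)) <= expR B.
    rewrite normc_cexp ler_expR; apply: le_trans (ler_norm _) _.
    apply: le_trans (ler_normc_Re _ _) _; rewrite normc_opp /g normcM normcV normc_nat.
    have := pm 0%N; rewrite expr0 mulr1 => pm0.
    by rewrite ler_pdivrMr // (le_trans pm0) // ler_peMr // ler1n.
  rewrite normcM; apply: le_trans (ler_pM _ _ hc gB) _; rewrite ?normc_ge0 //.
  apply: le_trans hD'; rewrite mulrC -!mulrA ler_wpM2l ?expR_ge0 // ler_wpM2l //.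
  move: (Num.sqrt N%:R)^-1 (invn_le_invsqrt R N) => r rN.
  have -> : (H * M + 1) * r = H * (M * r) + r by ring.
  by rewrite lerD2l.
have el := est (lam N) (lam_sig N) (dev N).
have e0' := est (zero_lam N) ltac:(by []) (dev0 N).
apply: (ratio_close _ _ _ _ _ _ _ _ _ _ e12
  (schur_normalized_ratio _ _ _ _ (lam_sig N) h0) el e0').
apply: hd; rewrite !powsum2_centered_points.
set m1 := position_mean R N (lam N) in hm *.
set m0 := position_mean R N (zero_lam N) in hm *.
set v1 := position_var R N (lam N) in hv *.
set v0 := position_var R N (zero_lam N) in hv *.
pose al := Num.sqrt N%:R * (m1 - m0 - Efun f); pose be := v1 - v0 - Sfun f.
have NE : N%:R = Num.sqrt N%:R ^+ 2 :> R by rewrite sqr_sqrtr ?ler0n.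
have yE (m : R) : h / (Num.sqrt N%:R)%:C * (N%:R * m)%:C = h * (Num.sqrt N%:R * m)%:C.
  have gen (r : R) : r%:C != 0 -> h / r%:C * (r ^+ 2 * m)%:C = h * (r * m)%:C.
    by move=> r0; rewrite expr2 !rmorphM; field.
  by rewrite -gen // -NE.
rewrite -/m1 -/m0 !yE.
have expand (r a b E u v S : R) : h * (r * a)%:C - h * (r * b)%:C +
   h ^+ 2 * u%:C / 2 - h ^+ 2 * v%:C / 2 -
   ((r * E)%:C * h + 1 / 2 * S%:C * h ^+ 2) =
   (r * (a - b - E))%:C * h + (u - v - S)%:C * h ^+ 2 / 2.
  by rewrite !rmorphM !rmorphB; field.
rewrite expand -/al -/be.
have hal : `|al| <= d / (2 * H ^+ 2) by move: hm; rewrite sub0r normrN.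
have hbe : `|be| <= d / (2 * H ^+ 2) by move: hv; rewrite distrC.
apply: le_trans (normc_add _ _ _) _.
rewrite (normcM al%:C) (normcM (be%:C * h ^+ 2)) (normcM be%:C) !normc_real.
rewrite normcX normcV normc_nat.
have HH : normc h ^+ 2 <= H ^+ 2 by rewrite lerXn2r ?nnegrE ?normc_ge0 // ltW.
have H2 : H <= H ^+ 2 by rewrite expr2 ler_peMl // ltW.
have t1 : `|al| * normc h <= d / (2 * H ^+ 2) * H ^+ 2.
  by apply: ler_pM => //; [exact: normc_ge0|exact: le_trans hH H2].
have t2 : `|be| * normc h ^+ 2 <= d / (2 * H ^+ 2) * H ^+ 2.
  by apply: ler_pM => //; exact: exprn_ge0 (normc_ge0 _ _).
have dE : d / (2 * H ^+ 2) * H ^+ 2 = d / 2.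
  by field; rewrite lt0r_neq0.
rewrite dE in t1 t2.
have t3 : 0 <= `|be| * normc h ^+ 2 by rewrite mulr_ge0 // exprn_ge0 // normc_ge0.
lra.
Qed.

(** [clog] inverts [cexp] only on the right half-plane, so the formula is exact from the rank where
    the ratio is close to 1, a rank that depends on [H] alone once [e] is fixed. *)
Lemma normalized_ratio_clog (H e : R) : 1 <= H -> 0 < e ->
  \forall N \near \oo, forall h, normc h <= H ->
    schur_normalized (lam N) (cexp (h / (Num.sqrt N%:R)%:C)) =
      cexp ((Num.sqrt N%:R * Efun f)%:C * h + 1 / 2 * (Sfun f)%:C * h ^+ 2
            + clog R (normalized_ratio N h))
    /\ normc (clog R (normalized_ratio N h)) <= e.
Proof.
move=> H1 e0; have [d d0 hd] := clog_small R e e0.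
pose e' := Num.min (d / 8) (1 / 2).
have e'0 : 0 < e' by rewrite lt_min !divr_gt0.
have := normalized_ratio_close H e' H1 e'0; rewrite ge_min lexx orbT => /(_ isT).
apply: filterS => N hN h hH; have := hN h hH => k.
have kd : normc (normalized_ratio N h - 1) <= d.
  apply: le_trans k _; have : e' <= d / 8 by rewrite ge_min lexx.
  by lra.
have [re0 small] := hd _ kd; split => //.
by rewrite cexpD clogK // /normalized_ratio [RHS]mulrC divfK ?cexp_neq0.
Qed.

End Close.

(** * Compact sets and the final statement *)

(** The norm of [R[i]] takes its values in [R[i]], whereas the estimates use the real modulus;
    boundedness is therefore read off the image of [K] in [R]. *)
Lemma compact_normc_bounded (R : realType) (K : set (R[i])^o) : compact K ->
  exists2 H : R, 1 <= H & forall h : R[i], K h -> normc h <= H.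
Proof.
move=> cK; have nc : continuous (@normc R : (R[i])^o -> R).
  move=> z; apply/(@cvgrPdist_le _ _ _ (nbhs (z : (R[i])^o)) (nbhs_filter _)) => e e0.
  have e0' : 0 < e%:C :> R[i] by rewrite -(rmorph0 (real_complex R)) ltcR.
  apply/nbhs_ballP; exists e%:C => //= w; rewrite /ball /= => hw.
  have {}hw : normc (z - w) < e by move: hw; rewrite -ltcR.
  have := normc_add R (z - w) w; have := normc_add R (w - z) z.
  rewrite !subrK (normc_subC _ w) => k1 k2.
  by rewrite ler_norml; apply/andP; split; lra.
have /compact_bounded [M [_ hM]] := continuous_compact (continuous_subspaceT nc) cK.
exists (Num.max 1 (M + 1)); first by rewrite le_max lexx.
move=> h Kh; rewrite le_max; apply/orP; right.
apply: le_trans (ler_norm _) _; apply: (hM (M + 1)); first by rewrite ltrDl.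
by exists h.
Qed.

Theorem proposition4p8 (R : realType) (lam : forall N : nat, 'I_N -> int)
    (f : R -> R)
    (lam_sig : forall N : nat, signature (lam N))
    (f_decr : weakly_decreasing01 f)
    (f_diff : piecewise_differentiable01 f)
    (R_infty_bounded : exists C : R, forall N : nat, R_infty (lam N) f <= C)
    (R_1_small : R_1 (lam N) f / Num.sqrt N%:R @[N --> \oo] --> (0 : R)) :
  exists o : nat -> R[i] -> (R[i])^o,
    (forall h : R[i],
        (\forall N \near \oo,
          schur_normalized (lam N) (cexp (h / (Num.sqrt N%:R)%:C)) =
          cexp ((Num.sqrt N%:R * Efun f)%:C * h
                + 1 / 2 * (Sfun f)%:C * h ^+ 2 + o N h))
        /\ o N h @[N --> \oo] --> (0 : (R[i])^o))
    /\
    (forall K : set (R[i])^o, compact K -> K `<=` [set~ 0] ->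
        (\forall N \near \oo, forall h : R[i], K h ->
          schur_normalized (lam N) (cexp (h / (Num.sqrt N%:R)%:C)) =
          cexp ((Num.sqrt N%:R * Efun f)%:C * h
                + 1 / 2 * (Sfun f)%:C * h ^+ 2 + o N h))
        /\ {uniform K, o @ \oo --> (fun=> 0 : (R[i])^o)}).
Proof.
have [C hC] := R_infty_bounded.
have main := normalized_ratio_clog R lam f C lam_sig f_decr hC R_1_small.
(* The radii of the topology on [R[i]] are complex numbers; a positive one is real. *)
have posC (e : R[i]) : 0 < e -> exists2 r : R, 0 < r & e = r%:C.
  by case: e => a b; rewrite ltcE /= => /andP[/eqP -> a0]; exists a.
exists (fun N h => clog R (normalized_ratio R lam f N h)); split.
  move=> h; pose H := Num.max 1 (normc h).
  have H1 : 1 <= H by rewrite le_max lexx.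
  have hH : normc h <= H by rewrite le_max lexx orbT.
  split; first by apply: filterS (main H 1 H1 ltr01) => N /(_ h hH) [].
  apply/cvgrPdist_le => e /posC [r r0 ->].
  apply: filterS (main H r H1 r0) => N /(_ h hH) [_ small].
  by rewrite sub0r normrN lecR.
move=> K cK _; have [H H1 hH] := compact_normc_bounded R K cK.
split; first by apply: filterS (main H 1 H1 ltr01) => N hN h /hH /hN [].
move=> P /uniform_nbhs [E [entE EP]]; rewrite /nbhs /=.
move: entE; rewrite -entourage_ballE => -[e /= /posC [r r0 eE] eEE].
(* The ball is open while [normalized_ratio_clog] bounds in the wide sense, hence the half. *)
have r2 : 0 < r / 2 by rewrite divr_gt0.
apply: filterS (main H _ H1 r2) => N hN; apply: EP => h /hH /hN [_ small].
apply: eEE; rewrite /= /ball /= eE sub0r normrN ltcR.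
by apply: le_lt_trans small _; lra.
Qed.
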